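(* Let $N_1,N_2\ge 0$ and let $(u,v)$ be an entire radial solution of the system $$\begin{cases}\Delta u=-2e^u+e^v+4e^{2u}-2e^{2v}-e^{u+v}+4\pi N_1\delta_0\\ \Delta v=e^u-2e^v-2e^{2u}+4e^{2v}-e^{u+v}+4\pi N_2\delta_0\end{cases}\quad\text{in }\mathbb{R}^2.$$ Then there exists $R_0\ge 0$ such that one of the following holds: (1) $u(r)$ and $v(r)$ are less than $\log\frac12$ for $r\ge R_0$; or (2) $(u,v)$ is a topological solution. Furthermore, (a) $(u,v)$ is a topological solution if and only if $r(u+v)_r(r)>0$ on $(0,\infty)$; (b) in case (2), the two components $u$ and $v$ have no intersection on $(R_0,\infty)$ and are increasing to $0$ as $r\to\infty$.
   Context: Here $\delta_0$ is the Dirac measure at the origin of $\mathbb{R}^2$, $r=|x|$, and the subscript $r$ denotes differentiation in $r$. An entire radial solution is a pair of radial functions $u(r),v(r)$ defined for all $r\in(0,\infty)$ that solves the system and satisfies $u(r)=2N_1\log r+O(1)$ and $v(r)=2N_2\log r+O(1)$ as $r\to0^+$. A topological solution is a solution with $(u(r),v(r))\to(0,0)$ as $r\to\infty$. An intersection of $u$ and $v$ is a point $r$ with $u(r)=v(r)$.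
   Formalization: The zero solution u=v=0 (N1=N2=0) is excluded from (a) and from the strict increase in (b), and solutions with u=v identically are excluded from the no-intersection claim in (b); the statement is false in exactly those cases. *)

(* Defs.v *)
From Stdlib Require Import Reals.
From Coquelicot Require Import Coquelicot.
Open Scope R_scope.

Definition laplacian (U : R -> R -> R) (x y : R) : R :=
  Derive_n (fun s => U s y) 2 x + Derive_n (fun t => U x t) 2 y.

(* The planar function x |-> f(|x|); a profile f : R -> R is only meaningful
   on (0, +oo), and its values elsewhere are never used. *)
Definition radial (f : R -> R) (x y : R) : R := f (sqrt (x ^ 2 + y ^ 2)).

Definition rhs_u (a b : R) : R :=
  - 2 * exp a + exp b + 4 * exp (2 * a) - 2 * exp (2 * b) - exp (a + b).

Definition rhs_v (a b : R) : R :=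
  exp a - 2 * exp b - 2 * exp (2 * a) + 4 * exp (2 * b) - exp (a + b).

(* f(r) = 2 N log r + O(1) as r -> 0+ *)
Definition log_singularity (N : R) (f : R -> R) : Prop :=
  exists C delta : R, 0 < delta /\
    forall r, 0 < r < delta -> Rabs (f r - 2 * N * ln r) <= C.

Definition twice_derivable_pos (f : R -> R) : Prop :=
  forall r, 0 < r -> ex_derive f r /\ ex_derive (Derive f) r.

(* Away from the origin the system holds classically and the Dirac masses do
   not contribute.  At the origin the source 4 pi N delta_0 is carried by the
   singularity 2 N log r = 4 pi N * ((1 / (2 pi)) log r): the remainder is
   bounded and its Laplacian is bounded near 0, so the equation extends across
   the origin as an equation of distributions with exactly that source. *)
Definition entire_radial_solution (N1 N2 : R) (u v : R -> R) : Prop :=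
  twice_derivable_pos u /\ twice_derivable_pos v /\
  (forall x y : R, (x, y) <> (0, 0) ->
     laplacian (radial u) x y = rhs_u (radial u x y) (radial v x y) /\
     laplacian (radial v) x y = rhs_v (radial u x y) (radial v x y)) /\
  log_singularity N1 u /\ log_singularity N2 v.

Definition topological_solution (N1 N2 : R) (u v : R -> R) : Prop :=
  entire_radial_solution N1 N2 u v /\
  is_lim u p_infty 0 /\ is_lim v p_infty 0.

Definition intersection (u v : R -> R) (r : R) : Prop := u r = v r.

Definition increasing_on_ray (R0 : R) (f : R -> R) : Prop :=
  forall r s, R0 < r -> r < s -> f r < f s.

(* Two degenerate configurations.  For N1 = N2 = 0 the pair (0, 0) is a
   topological solution along which r (u + v)_r is 0 and neither component is
   strictly increasing.  For N1 = N2 the ansatz u = v reduces the system to the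
   Chern-Simons-Higgs equation, which has a topological solution, and every
   r > 0 is then an intersection. *)
Definition trivial_pair (u v : R -> R) : Prop :=
  forall r, 0 < r -> u r = 0 /\ v r = 0.

Definition identical_pair (u v : R -> R) : Prop :=
  forall r, 0 < r -> u r = v r.

(* Main.v *)
Require Import Defs.
From Stdlib Require Import Reals Lra Psatz Classical.
From Coquelicot Require Import Coquelicot.
Open Scope R_scope.

(* In t = log r the system reads U'' = e^(2t) f, V'' = e^(2t) g, with a = e^U and
   b = e^V. For S = U + V and D = U - V,
     S'' = e^(2t) ((a + b)^2 / 2 + 3 (a - b)^2 / 2 - (a + b)),
     D'' = 3 e^(2t) (a - b) (2 (a + b) - 1).
   A Keller-Osserman argument gives S <= 0 and then U, V <= 0. If S has a finite
   limit, that limit is 0: otherwise either S'' stays away from 0, or D leaves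
   every bounded set once a + b > 1/2. Hence S' > 0 everywhere makes (u, v)
   topological. If S' <= 0 somewhere, then S' <= 0 from some time on: S' can only
   become positive where |D| is increasing, and there it would make the larger
   component convex and increasing, hence positive. So S -> -oo, one of a, b is
   small whenever the other is at least 1/2, and both end up below 1/2. For a
   topological solution D decays like e^(-3r) but S only like e^(-r), so that
   U'' and V'' are eventually negative. *)

(** * Calculus on the line *)

(** The number 1/2 has two sources: when b is negligible, U is forced by 2a(2a - 1), which changes
    sign at a = 1/2; and D is repelled from 0 exactly where a + b > 1/2. Since the forcings change
    sign, no maximum principle holds globally. The recurring substitute is convexity on a half-line:
    a moment with the right value and slope is found ([upcrossing]), convexity keeps the trajectory
    in the good region ([trapped_increasing]), and a bound that follows from U, V <= 0 is then
    violated. The decay rates come from the linearization at (0, 0), S'' = e^(2t) S and D'' = 9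
    e^(2t) D. The barriers use the rates 2 and 5/2 in place of 1 and 3: only the order 1 < 2 < 5/2 <
    3 matters, and the gaps absorb the nonlinearity and the first-order terms that e^(-kr) produces
    in the variable t. A zero of S is a common maximum of U and V, so uniqueness for the Cauchy
    problem makes the pair trivial; every other pair has S < 0 throughout. *)

Ltac derive_from_context :=
  auto_derive;
  [ repeat split; try (eexists; eassumption); auto
  | repeat match goal with
    | H : is_derive ?f ?t ?l |- context [Derive ?g ?t] =>
      replace (Derive g t) with l by (symmetry; exact (is_derive_unique f t l H))
    end; try ring ].

Lemma mean_value (f f' : R -> R) (a b : R) :
  a < b -> (forall t, a <= t <= b -> is_derive f t (f' t)) ->
  exists c, a < c < b /\ f b - f a = f' c * (b - a).
Proof.
  intros hab hf.
  destruct (MVT_cor2 f f' a b hab) as [c [hc1 hc2]].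
  - intros c hc. apply is_derive_Reals. auto.
  - exists c. split; [exact hc2 | exact hc1].
Qed.

Lemma nondecreasing (f f' : R -> R) (a b : R) :
  a <= b -> (forall t, a <= t <= b -> is_derive f t (f' t)) ->
  (forall t, a < t < b -> 0 <= f' t) -> f a <= f b.
Proof.
  intros hab hf hp. destruct (Rle_lt_or_eq_dec _ _ hab) as [h | ->]; [ | lra].
  destruct (mean_value f f' a b h hf) as [c [hc e]].
  specialize (hp c hc). nra.
Qed.

Lemma strictly_increasing (f f' : R -> R) (a b : R) :
  a < b -> (forall t, a <= t <= b -> is_derive f t (f' t)) ->
  (forall t, a < t < b -> 0 < f' t) -> f a < f b.
Proof.
  intros hab hf hp.
  destruct (mean_value f f' a b hab hf) as [c [hc e]].
  specialize (hp c hc). nra.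
Qed.

Lemma derive_continuous (f : R -> R) (l t : R) :
  is_derive f t l -> forall eps, 0 < eps ->
  exists d, 0 < d /\ forall s, Rabs (s - t) < d -> Rabs (f s - f t) < eps.
Proof.
  intros hf eps heps.
  assert (hc : continuous f t).
  { apply (ex_derive_continuous (K := R_AbsRing) (V := R_NormedModule)).
    exists l; exact hf. }
  apply continuity_pt_filterlim in hc.
  destruct (hc eps heps) as [d [hd h]].
  exists d. split; [exact hd | ]. intros s hs.
  destruct (Req_dec t s) as [-> | hne].
  - replace (f s - f s) with 0 by ring. rewrite Rabs_R0. lra.
  - apply (h s). split; [split; [exact I | exact hne] | exact hs].
Qed.

Lemma derive_sign_near (f : R -> R) (l t : R) :
  is_derive f t l -> 0 < l ->
  exists d, 0 < d /\ forall s, t < s < t + d -> f t < f s.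
Proof.
  intros hf hl. apply is_derive_Reals in hf.
  destruct (hf l hl) as [d h].
  exists d. split; [apply cond_pos | ]. intros s hs.
  assert (hn : s - t <> 0) by lra.
  specialize (h (s - t) hn).
  rewrite Rabs_pos_eq in h by lra. specialize (h ltac:(lra)).
  replace (t + (s - t)) with s in h by ring.
  apply Rabs_def2 in h.
  assert (0 < (f s - f t) / (s - t)) by lra.
  assert ((f s - f t) = (f s - f t) / (s - t) * (s - t)) by (field; lra).
  nra.
Qed.

Lemma left_increasing_derive (f : R -> R) (l t T : R) :
  is_derive f t l -> T < t -> (forall s, T <= s < t -> f s <= f t) -> 0 <= l.
Proof.
  intros hf hT hs. destruct (Rle_dec 0 l) as [h | h]; [exact h | exfalso].
  apply is_derive_Reals in hf.
  destruct (hf (- l) ltac:(lra)) as [d hd].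
  assert (hd0 := cond_pos d).
  set (e := Rmin (d / 2) (t - T)).
  assert (he : 0 < e <= d / 2 /\ e <= t - T).
  { unfold e. split; [split | ]; [apply Rmin_glb_lt; lra | apply Rmin_l | apply Rmin_r]. }
  specialize (hd (- e) ltac:(lra)).
  rewrite Rabs_Ropp, Rabs_pos_eq in hd by lra. specialize (hd ltac:(lra)).
  apply Rabs_def2 in hd.
  specialize (hs (t + - e) ltac:(lra)).
  assert ((f (t + - e) - f t) = (f (t + - e) - f t) / - e * - e) by (field; lra).
  nra.
Qed.

(** The supremum of the points up to which [P] holds is one of them by the closure hypothesis, and
    the opening hypothesis carries [P] beyond it. *)
Lemma real_induction (P : R -> Prop) (a : R) :
  P a ->
  (forall t, a <= t -> (forall s, a <= s <= t -> P s) ->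
     exists e, 0 < e /\ forall s, t < s < t + e -> P s) ->
  (forall t, a < t -> (forall s, a <= s < t -> P s) -> P t) ->
  forall t, a <= t -> P t.
Proof.
  intros h0 hopen hclosed t ht. apply NNPP. intros hn.
  set (E := fun x => a <= x <= t /\ forall s, a <= s <= x -> P s).
  destruct (completeness E) as [m [hub hlub]].
  - exists t. intros x [hx _]. lra.
  - exists a. split; [lra | ]. intros s hs. replace s with a by lra. exact h0.
  - assert (ham : a <= m).
    { apply hub. split; [lra | ]. intros s hs. replace s with a by lra. exact h0. }
    assert (hbelow : forall s, a <= s < m -> P s).
    { intros s hs. apply NNPP. intros hs'.
      assert (m <= s); [ | lra]. apply hlub. intros x [hx hxP].
      destruct (Rle_dec x s); [assumption | ]. exfalso. apply hs', hxP. lra. }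
    assert (hm : P m).
    { destruct (Rle_lt_or_eq_dec _ _ ham) as [h | <-]; [ | exact h0].
      apply hclosed; assumption. }
    assert (hmall : forall s, a <= s <= m -> P s).
    { intros s hs. destruct (Req_dec s m) as [-> | hne]; [exact hm | ].
      apply hbelow. lra. }
    assert (hmt : m <= t) by (apply hlub; intros x [hx _]; lra).
    assert (hmt' : m < t).
    { destruct (Rle_lt_or_eq_dec _ _ hmt) as [h | h]; [exact h | ].
      subst m. contradiction. }
    destruct (hopen m ham hmall) as [e [he heP]].
    set (x := Rmin t (m + e / 2)).
    assert (hx : m < x /\ x <= t /\ x <= m + e / 2).
    { unfold x. split; [apply Rmin_glb_lt; lra | split; [apply Rmin_l | apply Rmin_r]]. }
    assert (x <= m); [ | lra]. apply hub. split; [lra | ].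
    intros s hs. destruct (Rle_dec s m) as [h | h]; [apply hmall; lra | apply heP; lra].
Qed.

(** The zero is the supremum of all points of [a, b] where w <= 0, not the first exit from that set;
    hence w is positive on the whole rest of the interval. *)
Lemma last_zero (w w' : R -> R) (a b : R) :
  a < b -> (forall t, a <= t <= b -> is_derive w t (w' t)) ->
  w a <= 0 -> 0 < w b ->
  exists c, a <= c < b /\ w c = 0 /\ forall t, c < t <= b -> 0 < w t.
Proof.
  intros hab hw ha hb.
  set (E := fun x => a <= x <= b /\ w x <= 0).
  destruct (completeness E) as [m [hub hlub]].
  - exists b. intros x [hx _]. lra.
  - exists a. split; [lra | exact ha].
  - assert (ham : a <= m) by (apply hub; split; lra).
    assert (hmb : m <= b) by (apply hlub; intros x [hx _]; lra).
    assert (hpos : forall t, m < t <= b -> 0 < w t).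
    { intros t ht. destruct (Rlt_dec 0 (w t)) as [h | h]; [exact h | exfalso].
      assert (t <= m); [apply hub; split; lra | lra]. }
    assert (hle : w m <= 0).
    { destruct (Rle_dec (w m) 0) as [h | h]; [exact h | exfalso].
      destruct (derive_continuous w (w' m) m (hw m ltac:(lra)) (w m) ltac:(lra))
        as [d [hd hdm]].
      assert (m <= m - d / 2); [ | lra].
      apply hlub. intros x [hx hx0].
      assert (x <= m) by (apply hub; split; assumption).
      destruct (Rle_dec x (m - d / 2)) as [h' | h']; [exact h' | exfalso].
      specialize (hdm x). rewrite (Rabs_left1 (x - m)) in hdm by lra.
      specialize (hdm ltac:(lra)). apply Rabs_def2 in hdm. lra. }
    assert (hmb' : m < b).
    { destruct (Rle_lt_or_eq_dec _ _ hmb) as [h | ->]; [exact h | lra]. }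
    exists m. split; [lra | split; [ | exact hpos]].
    apply Rle_antisym; [exact hle | ].
    destruct (Rle_dec 0 (w m)) as [h | h]; [exact h | exfalso].
    destruct (derive_continuous w (w' m) m (hw m ltac:(lra)) (- w m) ltac:(lra))
      as [d [hd hdm]].
    set (x := Rmin b (m + d / 2)).
    assert (hx : m < x /\ x <= b /\ x <= m + d / 2).
    { unfold x. split; [apply Rmin_glb_lt; lra | split; [apply Rmin_l | apply Rmin_r]]. }
    specialize (hdm x). rewrite (Rabs_pos_eq (x - m)) in hdm by lra.
    specialize (hdm ltac:(lra)). apply Rabs_def2 in hdm.
    specialize (hpos x ltac:(lra)). lra.
Qed.

(** Past the last time at level l, the mean value theorem yields a value above l and a positive
    slope at the same point: the initial data for [trapped_increasing]. *)
Lemma upcrossing (w w' : R -> R) (l a b : R) :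
  a < b -> (forall t, a <= t <= b -> is_derive w t (w' t)) ->
  w a <= l -> l < w b ->
  exists c, a < c < b /\ l < w c /\ 0 < w' c.
Proof.
  intros hab hw ha hb.
  assert (hw' : forall t, a <= t <= b -> is_derive (fun s => w s - l) t (w' t)).
  { intros t ht. specialize (hw t ht). derive_from_context. }
  destruct (last_zero (fun s => w s - l) w' a b hab hw') as [c [hc [hc0 hcp]]]; [lra | lra | ].
  destruct (mean_value w w' c b ltac:(lra)) as [x [hx e]].
  { intros t ht. apply hw. lra. }
  exists x. specialize (hcp x ltac:(lra)).
  split; [lra | split; [lra | ]].
  apply Rnot_le_lt. intros hn. nra.
Qed.

(** Nonnegative slopes keep both functions above their initial values, there both are strictly
    convex, and convexity keeps the slopes nonnegative. Two functions are treated together because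
    the convexity of one may depend on the size of the other; a scalar argument passes the same
    function twice. *)
Lemma trapped_increasing (w1 w1' w1'' w2 w2' w2'' : R -> R) (a : R) :
  (forall t, a <= t -> is_derive w1 t (w1' t)) ->
  (forall t, a <= t -> is_derive w1' t (w1'' t)) ->
  (forall t, a <= t -> is_derive w2 t (w2' t)) ->
  (forall t, a <= t -> is_derive w2' t (w2'' t)) ->
  (forall t, a <= t -> w1 a <= w1 t -> w2 a <= w2 t -> 0 < w1'' t /\ 0 < w2'' t) ->
  0 <= w1' a -> 0 <= w2' a ->
  forall t, a <= t -> w1 a <= w1 t /\ w2 a <= w2 t /\ 0 <= w1' t /\ 0 <= w2' t.
Proof.
  intros d1 d1' d2 d2' hconv h1 h2.
  assert (hval : forall t, a <= t -> (forall s, a <= s < t -> 0 <= w1' s /\ 0 <= w2' s) ->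
            w1 a <= w1 t /\ w2 a <= w2 t).
  { intros t ht hs. split.
    - apply (nondecreasing w1 w1'); [exact ht | intros; apply d1; lra | ].
      intros s hs'. apply hs. lra.
    - apply (nondecreasing w2 w2'); [exact ht | intros; apply d2; lra | ].
      intros s hs'. apply hs. lra. }
  assert (hder : forall t, a <= t -> 0 <= w1' t /\ 0 <= w2' t).
  { apply (real_induction (fun t => 0 <= w1' t /\ 0 <= w2' t)).
    - split; assumption.
    - intros t ht hs.
      destruct (hval t ht) as [v1 v2]. { intros; apply hs; lra. }
      destruct (hconv t ht v1 v2) as [c1 c2].
      destruct (derive_sign_near _ _ _ (d1' t ht) c1) as [e1 [he1 hp1]].
      destruct (derive_sign_near _ _ _ (d2' t ht) c2) as [e2 [he2 hp2]].
      destruct (hs t ltac:(lra)) as [p1 p2].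
      exists (Rmin e1 e2). split; [apply Rmin_glb_lt; assumption | ].
      intros s hs'. assert (Rmin e1 e2 <= e1) by apply Rmin_l.
      assert (Rmin e1 e2 <= e2) by apply Rmin_r.
      specialize (hp1 s ltac:(lra)). specialize (hp2 s ltac:(lra)). lra.
    - intros t ht hs.
      assert (hcl : forall w w'', is_derive w t w'' -> (forall s, a <= s < t -> 0 <= w s) -> 0 <= w t).
      { intros w w'' hd hpos. destruct (Rle_dec 0 (w t)) as [h | h]; [exact h | exfalso].
        destruct (derive_continuous w w'' t hd (- w t) ltac:(lra)) as [d [hd0 hdt]].
        set (x := Rmax a (t - d / 2)).
        assert (hx : a <= x /\ t - d / 2 <= x /\ x < t).
        { unfold x. split; [apply Rmax_l | split; [apply Rmax_r | apply Rmax_lub_lt; lra]]. }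
        specialize (hdt x). rewrite (Rabs_left1 (x - t)) in hdt by lra.
        specialize (hdt ltac:(lra)). apply Rabs_def2 in hdt.
        specialize (hpos x ltac:(lra)). lra. }
      split.
      + apply (hcl w1' (w1'' t)); [apply d1'; lra | intros; apply hs; lra].
      + apply (hcl w2' (w2'' t)); [apply d2'; lra | intros; apply hs; lra]. }
  intros t ht. destruct (hval t ht) as [v1 v2]. { intros; apply hder; lra. }
  destruct (hder t ht). auto.
Qed.

Lemma convex_bounded_nonincreasing (w w' w'' : R -> R) (a M : R) :
  (forall t, a <= t -> is_derive w t (w' t)) ->
  (forall t, a <= t -> is_derive w' t (w'' t)) ->
  (forall t, a <= t -> 0 <= w'' t) ->
  (forall t, a <= t -> w t <= M) ->
  forall t, a <= t -> w' t <= 0.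
Proof.
  intros d d' hc hM t ht. apply Rnot_lt_le. intros hp.
  (* One unit past the point where the tangent line at t reaches the height M. *)
  set (x := t + (M - w t) / w' t + 1).
  assert (hq : 0 <= (M - w t) / w' t).
  { apply Rdiv_le_0_compat; [specialize (hM t ht); lra | exact hp]. }
  destruct (mean_value w w' t x) as [c [hc1 e]].
  - unfold x; lra.
  - intros s hs; apply d; lra.
  - assert (w' t <= w' c).
    { apply (nondecreasing w' w''); [lra | intros; apply d'; lra | intros; apply hc; lra]. }
    specialize (hM x ltac:(unfold x; lra)).
    assert (w' t * (x - t) = M - w t + w' t) by (unfold x; field; lra).
    assert (w' t * (x - t) <= w' c * (x - t)) by (apply Rmult_le_compat_r; lra).
    lra.
Qed.

Lemma uniformly_convex_unbounded (w w' w'' : R -> R) (a c M : R) :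
  0 < c ->
  (forall t, a <= t -> is_derive w t (w' t)) ->
  (forall t, a <= t -> is_derive w' t (w'' t)) ->
  (forall t, a <= t -> c <= w'' t) ->
  (forall t, a <= t -> w t <= M) -> False.
Proof.
  intros hc d d' hcv hM.
  assert (hn := convex_bounded_nonincreasing w w' w'' a M d d'
    ltac:(intros t ht; specialize (hcv t ht); lra) hM).
  (* A slope growing at rate at least c would be at least c here. *)
  set (x := a - w' a / c + 1).
  assert (ha := hn a ltac:(lra)).
  assert (hq : w' a / c <= 0).
  { apply (Rmult_le_reg_r c); [exact hc | ]. unfold Rdiv.
    rewrite Rmult_assoc, Rinv_l by lra. lra. }
  destruct (mean_value w' w'' a x) as [y [hy e]].
  - unfold x; lra.
  - intros; apply d'; lra.
  - specialize (hcv y ltac:(lra)). specialize (hn x ltac:(unfold x; lra)).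
    assert (c * (x - a) = - w' a + c) by (unfold x; field; lra).
    assert (c * (x - a) <= w'' y * (x - a)) by (apply Rmult_le_compat_r; [unfold x; lra | lra]).
    lra.
Qed.

(** The bound [M] acts as a boundary condition at infinity: after an upcrossing of 0, z would be
    convex with positive slope, hence unbounded. *)
Lemma half_line_max_principle (z z' z'' : R -> R) (a M : R) :
  (forall t, a <= t -> is_derive z t (z' t)) ->
  (forall t, a <= t -> is_derive z' t (z'' t)) ->
  (forall t, a <= t -> 0 < z t -> 0 < z'' t) ->
  z a <= 0 -> (forall t, a <= t -> z t <= M) ->
  forall t, a <= t -> z t <= 0.
Proof.
  intros d d' hc ha hM t ht. apply Rnot_lt_le. intros hp.
  assert (hat : a < t).
  { destruct (Rle_lt_or_eq_dec _ _ ht) as [h | <-]; [exact h | lra]. }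
  destruct (upcrossing z z' 0 a t hat ltac:(intros; apply d; lra) ha hp) as [c [hc1 [hc2 hc3]]].
  assert (tr := trapped_increasing z z' z'' z z' z'' c
    ltac:(intros; apply d; lra) ltac:(intros; apply d'; lra)
    ltac:(intros; apply d; lra) ltac:(intros; apply d'; lra)
    ltac:(intros s hs h1 h2; split; apply hc; lra) ltac:(lra) ltac:(lra)).
  assert (z' c <= 0); [ | lra].
  apply (convex_bounded_nonincreasing z z' z'' c M); [intros; apply d; lra | intros; apply d'; lra | | intros; apply hM; lra | lra].
  intros s hs. destruct (tr s hs). left. apply hc; lra.
Qed.

Lemma exp_ge_linear (x : R) : 1 + x <= exp x.
Proof.
  destruct (Req_dec x 0) as [-> | h]; [rewrite exp_0; lra | ].
  left. apply exp_ineq1. exact h.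
Qed.

Lemma exp_le (x y : R) : x <= y -> exp x <= exp y.
Proof. intros [h | ->]; [left; apply exp_increasing; lra | lra]. Qed.

Lemma quadratic_blowup (w w' w'' : R -> R) (a c : R) :
  0 < c ->
  (forall t, a <= t -> is_derive w t (w' t)) ->
  (forall t, a <= t -> is_derive w' t (w'' t)) ->
  (forall t, a <= t -> 0 < w t) -> (forall t, a <= t -> 0 < w' t) ->
  (forall t, a <= t -> c * w t ^ 2 <= w'' t) -> False.
Proof.
  intros hc d d' hw hw' hq.
  assert (hmon : forall s t, a <= s <= t -> w s <= w t).
  { intros s t hst. apply (nondecreasing w w'); [lra | intros; apply d; lra | ].
    intros x hx. left. apply hw'. lra. }
  (* The energy of the equation w'' = c w^2, nondecreasing since w' > 0. *)
  set (en := fun t => w' t ^ 2 / 2 - c * w t ^ 3 / 3).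
  assert (hen : forall t, a <= t -> en a <= en t).
  { intros t ht.
    apply (nondecreasing en (fun t => w' t * (w'' t - c * w t ^ 2))); [exact ht | | ].
    - intros s hs. assert (h1 := d s ltac:(lra)). assert (h2 := d' s ltac:(lra)).
      unfold en. derive_from_context. field.
    - intros s hs. specialize (hq s ltac:(lra)). specialize (hw' s ltac:(lra)).
      apply Rmult_le_pos; lra. }
  (* Where w >= B the initial energy is absorbed: 6 |en a| <= c w turns the energy inequality into
     w'^2 >= (c / 3) w^3. *)
  set (B := 1 + 6 * Rabs (en a) / c).
  assert (hBc : 0 <= 6 * Rabs (en a) / c).
  { apply Rdiv_le_0_compat; [ | exact hc]. assert (h := Rabs_pos (en a)). lra. }
  assert (hlarge : exists T, a <= T /\ B <= w T).
  { apply NNPP. intros hn.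
    apply (uniformly_convex_unbounded w w' w'' a (c * w a ^ 2) B);
      [ | exact d | exact d' | | ].
    - specialize (hw a ltac:(lra)). apply Rmult_lt_0_compat; [exact hc | nra].
    - intros t ht. eapply Rle_trans; [ | apply (hq t ht)].
      apply Rmult_le_compat_l; [lra | ].
      apply pow_incr. split; [left; apply hw; lra | apply hmon; lra].
    - intros t ht. apply Rnot_lt_le. intros h. apply hn. exists t. lra. }
  destruct hlarge as [T [haT hBT]].
  set (k := sqrt (c / 3)).
  assert (hk2 : k * k = c / 3) by (apply sqrt_sqrt; lra).
  assert (hk : 0 < k) by (apply sqrt_lt_R0; lra).
  assert (hslope : forall t, T <= t -> k * (w t * sqrt (w t)) <= w' t).
  { intros t ht. assert (hwB : B <= w t).
    { eapply Rle_trans; [exact hBT | apply hmon; lra]. }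
    assert (h1 : 1 <= w t) by (unfold B in hwB; lra).
    assert (hs : sqrt (w t) * sqrt (w t) = w t) by (apply sqrt_sqrt; lra).
    apply Rsqr_incr_0_var; [ | left; apply hw'; lra].
    unfold Rsqr.
    replace (k * (w t * sqrt (w t)) * (k * (w t * sqrt (w t))))
      with (k * k * (w t ^ 2 * (sqrt (w t) * sqrt (w t)))) by ring.
    rewrite hk2, hs.
    assert (he := hen t ltac:(lra)). unfold en at 2 in he.
    assert (hab : - Rabs (en a) <= en a).
    { assert (h := Rle_abs (- en a)). rewrite Rabs_Ropp in h. lra. }
    assert (hcB : 6 * Rabs (en a) <= c * w t).
    { assert (6 * Rabs (en a) = c * (6 * Rabs (en a) / c)) by (field; lra).
      assert (c * (6 * Rabs (en a) / c) <= c * w t); [ | lra].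
      apply Rmult_le_compat_l; [lra | unfold B in hwB; lra]. }
    assert (hw3 : c * w t <= c * w t ^ 3).
    { apply Rmult_le_compat_l; [lra | nra]. }
    nra. }
  (* In this variable w' >= k w^(3/2) reads z' <= -k / 2, so the positive function z would reach 0
     by time T + 2 z(T) / k. *)
  set (z := fun t => / sqrt (w t)).
  assert (hz : forall t, T <= t ->
            is_derive z t (- w' t / (2 * (w t * sqrt (w t))))).
  { intros t ht. assert (h1 := d t ltac:(lra)). assert (h2 := hw t ltac:(lra)).
    assert (h3 := sqrt_lt_R0 _ h2).
    unfold z. derive_from_context.
    - lra.
    - replace (w t * sqrt (w t)) with (sqrt (w t) * (sqrt (w t) * 1) * sqrt (w t))
        by (rewrite <- (sqrt_sqrt (w t)) at 4 by lra; ring).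
      field. lra. }
  destruct (mean_value z (fun t => - w' t / (2 * (w t * sqrt (w t)))) T (T + 2 * z T / k))
    as [x [hx e]].
  { assert (h2 := hw T ltac:(lra)). assert (h3 := sqrt_lt_R0 _ h2).
    assert (0 < z T) by (apply Rinv_0_lt_compat; exact h3).
    assert (0 < 2 * z T / k) by (apply Rdiv_lt_0_compat; lra). lra. }
  { intros; apply hz; lra. }
  assert (hzp : forall t, T <= t -> 0 < z t).
  { intros t ht. apply Rinv_0_lt_compat, sqrt_lt_R0, hw. lra. }
  assert (hsl : - w' x / (2 * (w x * sqrt (w x))) <= - k / 2).
  { assert (h2 := hw x ltac:(lra)). assert (h3 := sqrt_lt_R0 _ h2).
    assert (hp : 0 < w x * sqrt (w x)) by (apply Rmult_lt_0_compat; assumption).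
    apply (Rmult_le_reg_r (2 * (w x * sqrt (w x)))); [lra | ].
    replace (- w' x / (2 * (w x * sqrt (w x))) * (2 * (w x * sqrt (w x))))
      with (- w' x) by (field; split; lra).
    specialize (hslope x ltac:(lra)). lra. }
  assert (hT := hzp T ltac:(lra)).
  assert (hgt : 0 < 2 * z T / k) by (apply Rdiv_lt_0_compat; lra).
  assert (hend := hzp (T + 2 * z T / k) ltac:(lra)).
  replace (T + 2 * z T / k - T) with (2 * z T / k) in e by ring.
  assert (- k / 2 * (2 * z T / k) = - z T) by (field; lra).
  assert (- w' x / (2 * (w x * sqrt (w x))) * (2 * z T / k) <= - k / 2 * (2 * z T / k))
    by (apply Rmult_le_compat_r; lra).
  lra.
Qed.

(* A Keller-Osserman argument: a positive value would propagate either to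
   minus infinity, against the upper bound there, or to a finite-time blow-up. *)
Lemma nonpositive_of_quadratic_growth (w w' w'' : R -> R) (T M : R) :
  (forall t, is_derive w t (w' t)) -> (forall t, is_derive w' t (w'' t)) ->
  (forall t, 0 < w t -> exp (2 * t) * (w t ^ 2 / 2) <= w'' t) ->
  (forall t, t <= T -> w t <= M) ->
  forall t, w t <= 0.
Proof.
  intros d d' hq hM t0. apply Rnot_lt_le. intros hp.
  assert (hconv : forall t, 0 < w t -> 0 < w'' t).
  { intros t ht. eapply Rlt_le_trans; [ | apply (hq t ht)].
    apply Rmult_lt_0_compat; [apply exp_pos | nra]. }
  assert (hstart : exists c, 0 < w c /\ 0 < w' c).
  { destruct (classic (exists t1, t1 < t0 /\ w t1 <= 0)) as [[t1 [h1 h2]] | hn].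
    - destruct (upcrossing w w' 0 t1 t0 h1 ltac:(auto) h2 hp) as [c [_ hc]].
      exists c. exact hc.
    - assert (hpos : forall t, t <= t0 -> 0 < w t).
      { intros t ht. apply Rnot_le_lt. intros h. apply hn. exists t. split; [ | exact h].
        destruct ht as [ht | ->]; [exact ht | lra]. }
      destruct (Rlt_dec 0 (w' t0)) as [h | h]; [exists t0; auto | exfalso].
      assert (h1 : w' (t0 - 1) < w' t0).
      { apply (strictly_increasing w' w''); [lra | auto | ].
        intros t ht. apply hconv, hpos. lra. }
      (* Here w is positive, hence convex, on the whole past, with slope at most -k before t0 - 1.
         Backward it grows at least linearly and exceeds M at time x. *)
      set (k := - w' (t0 - 1)). assert (hk : 0 < k) by (unfold k; lra).
      set (x := Rmin T (t0 - 2 - Rmax 0 (M - w (t0 - 1)) / k)).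
      assert (hm : 0 <= Rmax 0 (M - w (t0 - 1)) / k).
      { apply Rdiv_le_0_compat; [apply Rmax_l | exact hk]. }
      assert (hx1 : x <= t0 - 2 - Rmax 0 (M - w (t0 - 1)) / k) by apply Rmin_r.
      specialize (hM x (Rmin_l _ _)).
      destruct (mean_value w w' x (t0 - 1)) as [c [hc e]]; [lra | auto | ].
      assert (h2 : w' c <= w' (t0 - 1)).
      { apply (nondecreasing w' w''); [lra | auto | ].
        intros t ht. left. apply hconv, hpos. lra. }
      assert (h3 : w' c * (t0 - 1 - x) <= - k * (t0 - 1 - x)).
      { apply Rmult_le_compat_r; unfold k; lra. }
      assert (h4 : k * (Rmax 0 (M - w (t0 - 1)) / k + 1) <= k * (t0 - 1 - x)).
      { apply Rmult_le_compat_l; lra. }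
      replace (k * (Rmax 0 (M - w (t0 - 1)) / k + 1))
        with (Rmax 0 (M - w (t0 - 1)) + k) in h4 by (field; lra).
      assert (h5 := Rmax_r 0 (M - w (t0 - 1))). lra. }
  destruct hstart as [c [hc hc']].
  assert (tr := trapped_increasing w w' w'' w w' w'' c
    ltac:(auto) ltac:(auto) ltac:(auto) ltac:(auto)
    ltac:(intros s hs h1 h2; split; apply hconv; lra) ltac:(lra) ltac:(lra)).
  apply (quadratic_blowup w w' w'' c (exp (2 * c) / 2)); auto.
  - assert (h := exp_pos (2 * c)). lra.
  - intros t ht. destruct (tr t ht). lra.
  - intros t ht. apply Rlt_le_trans with (w' c); [exact hc' | ].
    apply (nondecreasing w' w''); [exact ht | auto | ].
    intros s hs. left. apply hconv. destruct (tr s ltac:(lra)). lra.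
  - intros t ht. destruct (tr t ht) as [h1 _].
    eapply Rle_trans; [ | apply hq; lra].
    assert (exp (2 * c) <= exp (2 * t)) by (apply exp_le; lra).
    assert (0 <= w t ^ 2 / 2) by nra. nra.
Qed.

(** Gronwall's argument for w^2 + w'^2, whose derivative is at most 1 + k e^(2t) times itself in
    absolute value. *)
Lemma second_order_uniqueness (w w' w'' : R -> R) (k t0 : R) :
  0 <= k ->
  (forall t, is_derive w t (w' t)) -> (forall t, is_derive w' t (w'' t)) ->
  (forall t, Rabs (w'' t) <= k * exp (2 * t) * Rabs (w t)) ->
  w t0 = 0 -> w' t0 = 0 -> forall t, w t = 0.
Proof.
  intros hk d d' hb h0 h0' t.
  set (K := fun x => k * exp (2 * x)).
  assert (hK : forall x y, x <= y -> 0 <= K x <= K y).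
  { intros x y hxy. unfold K. split.
    - apply Rmult_le_pos; [exact hk | left; apply exp_pos].
    - apply Rmult_le_compat_l; [exact hk | apply exp_le; lra]. }
  assert (hcross : forall s L, K s <= L ->
            Rabs (2 * w s * w' s + 2 * w' s * w'' s) <= (1 + L) * (w s ^ 2 + w' s ^ 2)).
  { intros s L hL. specialize (hb s). fold (K s) in hb.
    assert (hKs := hK s s (Rle_refl s)).
    replace (2 * w s * w' s + 2 * w' s * w'' s) with (2 * w' s * (w s + w'' s)) by ring.
    rewrite Rabs_mult, (Rabs_mult 2), (Rabs_pos_eq 2) by lra.
    assert (h1 := Rabs_triang (w s) (w'' s)).
    assert (h2 : K s * Rabs (w s) <= L * Rabs (w s)).
    { apply Rmult_le_compat_r; [apply Rabs_pos | exact hL]. }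
    rewrite <- (pow2_abs (w s)), <- (pow2_abs (w' s)).
    assert (h3 := Rabs_pos (w s)). assert (h4 := Rabs_pos (w' s)).
    assert (h5 : Rabs (w' s) * Rabs (w s + w'' s) <= Rabs (w' s) * ((1 + L) * Rabs (w s))).
    { apply Rmult_le_compat_l; lra. }
    assert (h6 : 0 <= (1 + L) * (Rabs (w s) - Rabs (w' s)) ^ 2).
    { apply Rmult_le_pos; [lra | apply pow2_ge_0]. }
    nra. }
  assert (hen : w t ^ 2 + w' t ^ 2 <= 0).
  { destruct (Rle_dec t0 t) as [h | h].
    (* On either side of t0 the weight is frozen at the right end of the interval, where the
       monotone function [K] is largest. *)
    - set (L := K t).
      assert (hle := nondecreasing
        (fun s => - ((w s ^ 2 + w' s ^ 2) * exp (- (1 + L) * s)))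
        (fun s => exp (- (1 + L) * s) *
           ((1 + L) * (w s ^ 2 + w' s ^ 2) - (2 * w s * w' s + 2 * w' s * w'' s))) t0 t h).
      cbv beta in hle. rewrite h0, h0' in hle.
      assert (hp := exp_pos (- (1 + L) * t)).
      assert (- ((0 ^ 2 + 0 ^ 2) * exp (- (1 + L) * t0)) <=
              - ((w t ^ 2 + w' t ^ 2) * exp (- (1 + L) * t))); [ | nra].
      apply hle.
      + intros s hs. assert (h1 := d s). assert (h2 := d' s). derive_from_context.
      + intros s hs. apply Rmult_le_pos; [left; apply exp_pos | ].
        specialize (hcross s L (proj2 (hK s t ltac:(lra)))).
        assert (hr := Rle_abs (2 * w s * w' s + 2 * w' s * w'' s)). lra.
    - set (L := K t0).
      assert (hle := nondecreasing
        (fun s => (w s ^ 2 + w' s ^ 2) * exp ((1 + L) * s))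
        (fun s => exp ((1 + L) * s) *
           ((1 + L) * (w s ^ 2 + w' s ^ 2) + (2 * w s * w' s + 2 * w' s * w'' s)))
        t t0 ltac:(lra)).
      cbv beta in hle. rewrite h0, h0' in hle.
      assert (hp := exp_pos ((1 + L) * t)).
      assert ((w t ^ 2 + w' t ^ 2) * exp ((1 + L) * t) <=
              (0 ^ 2 + 0 ^ 2) * exp ((1 + L) * t0)); [ | nra].
      apply hle.
      + intros s hs. assert (h1 := d s). assert (h2 := d' s). derive_from_context.
      + intros s hs. apply Rmult_le_pos; [left; apply exp_pos | ].
        specialize (hcross s L (proj2 (hK s t0 ltac:(lra)))).
        assert (hr := Rle_abs (- (2 * w s * w' s + 2 * w' s * w'' s))).
        rewrite Rabs_Ropp in hr. lra. }
  assert (h1 := pow2_ge_0 (w t)). assert (h2 := pow2_ge_0 (w' t)). nra.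
Qed.

(** * The system in logarithmic time *)

(* The system in the variable t = log r, where r d/dr becomes d/dt. *)
Record log_system (U U1 V V1 : R -> R) : Prop := {
  log_dU : forall t, is_derive U t (U1 t);
  log_dU1 : forall t, is_derive U1 t (exp (2 * t) * rhs_u (U t) (V t));
  log_dV : forall t, is_derive V t (V1 t);
  log_dV1 : forall t, is_derive V1 t (exp (2 * t) * rhs_v (U t) (V t));
  log_bounded : exists T M, forall t, t <= T -> U t <= M /\ V t <= M
}.

Lemma rhs_swap (x y : R) : rhs_v x y = rhs_u y x.
Proof. unfold rhs_u, rhs_v. rewrite (Rplus_comm y x). ring. Qed.

(** With a = [exp x] and b = [exp y], this splits off a(a - 1), the whole forcing when u = v; the
    remainder has the sign of a - b as soon as 3a + 2b > 1. *)
Lemma rhs_uE (x y : R) :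
  rhs_u x y = exp x * (exp x - 1) + (exp x - exp y) * (3 * exp x + 2 * exp y - 1).
Proof.
  unfold rhs_u. replace (2 * x) with (x + x) by ring. replace (2 * y) with (y + y) by ring.
  rewrite !exp_plus. ring.
Qed.

Definition sum_rhs (a b : R) : R := (a + b) ^ 2 / 2 + 3 * (a - b) ^ 2 / 2 - (a + b).

Lemma rhs_sum (x y : R) : rhs_u x y + rhs_v x y = sum_rhs (exp x) (exp y).
Proof. rewrite rhs_swap, !rhs_uE. unfold sum_rhs. field. Qed.

Lemma rhs_difference (x y : R) :
  rhs_u x y - rhs_v x y = 3 * (exp x - exp y) * (2 * (exp x + exp y) - 1).
Proof. rewrite rhs_swap, !rhs_uE. ring. Qed.

Lemma log_system_swap (U U1 V V1 : R -> R) :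
  log_system U U1 V V1 -> log_system V V1 U U1.
Proof.
  intros [h1 h2 h3 h4 [T [M h5]]]. split; auto.
  - intros t. rewrite <- rhs_swap. apply h4.
  - intros t. rewrite rhs_swap. apply h2.
  - exists T, M. intros t ht. destruct (h5 t ht). auto.
Qed.

Section LogSystem.
Context {U U1 V V1 : R -> R} (hs : log_system U U1 V V1).

Lemma sum_derive (t : R) : is_derive (fun s => U s + V s) t (U1 t + V1 t).
Proof. apply (is_derive_plus U V); [apply (log_dU _ _ _ _ hs) | apply (log_dV _ _ _ _ hs)]. Qed.

Lemma sum_derive2 (t : R) :
  is_derive (fun s => U1 s + V1 s) t (exp (2 * t) * sum_rhs (exp (U t)) (exp (V t))).
Proof.
  rewrite <- rhs_sum, Rmult_plus_distr_l.
  apply (is_derive_plus U1 V1); [apply (log_dU1 _ _ _ _ hs) | apply (log_dV1 _ _ _ _ hs)].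
Qed.

Lemma difference_derive (t : R) : is_derive (fun s => U s - V s) t (U1 t - V1 t).
Proof. apply (is_derive_minus U V); [apply (log_dU _ _ _ _ hs) | apply (log_dV _ _ _ _ hs)]. Qed.

Lemma difference_derive2 (t : R) :
  is_derive (fun s => U1 s - V1 s) t
    (exp (2 * t) * (3 * (exp (U t) - exp (V t)) * (2 * (exp (U t) + exp (V t)) - 1))).
Proof.
  rewrite <- rhs_difference, Rmult_minus_distr_l.
  apply (is_derive_minus U1 V1); [apply (log_dU1 _ _ _ _ hs) | apply (log_dV1 _ _ _ _ hs)].
Qed.

Lemma sum_nonpositive (t : R) : U t + V t <= 0.
Proof.
  destruct (log_bounded _ _ _ _ hs) as [T [M hM]].
  apply (nonpositive_of_quadratic_growth (fun s => U s + V s) (fun s => U1 s + V1 s)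
    (fun t => exp (2 * t) * sum_rhs (exp (U t)) (exp (V t))) T (M + M)).
  - apply sum_derive.
  - apply sum_derive2.
  - intros s hp. apply Rmult_le_compat_l; [left; apply exp_pos | ].
    (* By the arithmetic-geometric mean inequality a + b >= 2q, and q >= 1 + S/2; so the forcing is
       at least (a + b)(a + b - 2)/2 >= 2q(q - 1) >= S^2/2. *)
    set (q := exp ((U s + V s) / 2)).
    assert (hq : 1 + (U s + V s) / 2 <= q) by apply exp_ge_linear.
    assert (hqq : q * q = exp (U s) * exp (V s)).
    { unfold q. rewrite <- !exp_plus. f_equal. field. }
    assert (ha := exp_pos (U s)). assert (hb := exp_pos (V s)).
    unfold sum_rhs. set (a := exp (U s)) in *. set (b := exp (V s)) in *.
    assert (h2q : 2 * q <= a + b).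
    { apply Rsqr_incr_0_var; [unfold Rsqr; assert (h := pow2_ge_0 (a - b)); nra | lra]. }
    assert (2 * q * (2 * q - 2) <= (a + b) * (a + b - 2)) by (apply Rmult_le_compat; lra).
    assert ((U s + V s) / 2 * ((U s + V s) / 2) <= q * (q - 1)) by (apply Rmult_le_compat; lra).
    assert (h := pow2_ge_0 (a - b)). nra.
  - intros s h. destruct (hM s h). lra.
Qed.

End LogSystem.

(** Where U > 0, the bound on the sum gives V < 0, hence b < 1 < a; then both terms of [rhs_uE] are
    nonnegative and the first is at least U^2. *)
Lemma component_nonpositive {U U1 V V1 : R -> R} (hs : log_system U U1 V V1) (t : R) :
  U t <= 0.
Proof.
  destruct (log_bounded _ _ _ _ hs) as [T [M hM]].
  apply (nonpositive_of_quadratic_growth U U1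
    (fun t => exp (2 * t) * rhs_u (U t) (V t)) T M).
  - apply (log_dU _ _ _ _ hs).
  - apply (log_dU1 _ _ _ _ hs).
  - intros s hp. apply Rmult_le_compat_l; [left; apply exp_pos | ].
    assert (hsum := sum_nonpositive hs s).
    rewrite rhs_uE.
    assert (ha := exp_ge_linear (U s)).
    assert (hb : exp (V s) < exp (U s)) by (apply exp_increasing; lra).
    assert (hb' := exp_pos (V s)).
    assert (U s * U s <= exp (U s) * (exp (U s) - 1)) by (apply Rmult_le_compat; lra).
    assert (0 <= (exp (U s) - exp (V s)) * (3 * exp (U s) + 2 * exp (V s) - 1))
      by (apply Rmult_le_pos; lra).
    nra.
  - intros s h. apply hM, h.
Qed.

Lemma exp_le_one (x : R) : x <= 0 -> 0 < exp x <= 1.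
Proof.
  intros h. split; [apply exp_pos | ]. rewrite <- exp_0. apply exp_le, h.
Qed.

Lemma exp_lipschitz (x y : R) : x <= 0 -> y <= 0 -> Rabs (exp x - exp y) <= Rabs (x - y).
Proof.
  assert (main : forall x y, y <= x -> x <= 0 -> Rabs (exp x - exp y) <= Rabs (x - y)).
  { intros p q hqp hp. assert (h := exp_le_one p hp).
    assert (e : exp q = exp p * exp (q - p)) by (rewrite <- exp_plus; f_equal; ring).
    assert (h1 := exp_ge_linear (q - p)).
    assert (h2 := exp_le_one (q - p) ltac:(lra)).
    rewrite !Rabs_pos_eq by nra. nra. }
  intros hx hy. destruct (Rle_dec y x) as [h | h]; [apply main; assumption | ].
  rewrite (Rabs_minus_sym (exp x)), (Rabs_minus_sym x). apply main; lra.
Qed.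

Section Sign.
Context {U U1 V V1 : R -> R} (hs : log_system U U1 V V1).

Lemma both_nonpositive (t : R) : U t <= 0 /\ V t <= 0.
Proof.
  split; [apply (component_nonpositive hs) | ].
  apply (component_nonpositive (log_system_swap _ _ _ _ hs)).
Qed.

Lemma identical_of_contact (t0 : R) :
  U t0 = V t0 -> U1 t0 = V1 t0 -> forall t, U t = V t.
Proof.
  intros h0 h0' t.
  enough (U t - V t = 0) by lra.
  (* The constant 9 is the factor 3 of the forcing times the bound 3 for |2(a + b) - 1| with a, b in
     (0, 1]. *)
  apply (second_order_uniqueness (fun s => U s - V s) (fun s => U1 s - V1 s)
    (fun t => exp (2 * t) * (3 * (exp (U t) - exp (V t)) * (2 * (exp (U t) + exp (V t)) - 1)))
    9 t0); [lra | apply (difference_derive hs) | apply (difference_derive2 hs) | | lra | lra].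
  intros s. destruct (both_nonpositive s) as [hu hv].
  rewrite !Rabs_mult, (Rabs_pos_eq (exp (2 * s))), (Rabs_pos_eq 3)
    by (try lra; left; apply exp_pos).
  assert (hl := exp_lipschitz _ _ hu hv).
  assert (ha := exp_le_one _ hu). assert (hb := exp_le_one _ hv).
  assert (h3 : Rabs (2 * (exp (U s) + exp (V s)) - 1) <= 3) by (apply Rabs_le; lra).
  assert (he := exp_pos (2 * s)).
  assert (Rabs (exp (U s) - exp (V s)) * Rabs (2 * (exp (U s) + exp (V s)) - 1)
          <= Rabs (U s - V s) * 3) by (apply Rmult_le_compat; auto using Rabs_pos).
  nra.
Qed.

(** At t0 both components attain the maximal value 0, so their slopes vanish too. Uniqueness applies
    first to U - V and then, with the forcing reduced to a(a - 1), to U. *)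
Lemma trivial_of_sum_zero (t0 : R) :
  U t0 + V t0 = 0 -> forall t, U t = 0 /\ V t = 0.
Proof.
  intros h0.
  assert (hcrit : forall w w' : R -> R, (forall t, is_derive w t (w' t)) ->
            (forall t, w t <= 0) -> w t0 = 0 -> w' t0 = 0).
  { intros w w' d hw hz. apply Rle_antisym.
    - apply Rnot_lt_le. intros hp.
      destruct (derive_sign_near w _ t0 (d t0) hp) as [e [he h]].
      specialize (h (t0 + e / 2) ltac:(lra)). specialize (hw (t0 + e / 2)). lra.
    - apply (left_increasing_derive w (w' t0) t0 (t0 - 1) (d t0)); [lra | ].
      intros s _. rewrite hz. apply hw. }
  destruct (both_nonpositive t0) as [hu hv].
  assert (hu1 := hcrit U U1 (log_dU _ _ _ _ hs) (fun t => proj1 (both_nonpositive t)) ltac:(lra)).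
  assert (hv1 := hcrit V V1 (log_dV _ _ _ _ hs) (fun t => proj2 (both_nonpositive t)) ltac:(lra)).
  assert (heq := identical_of_contact t0 ltac:(lra) ltac:(lra)).
  assert (hU : forall t, U t = 0).
  { intros t. apply (second_order_uniqueness U U1
      (fun t => exp (2 * t) * rhs_u (U t) (V t)) 1 t0);
      [lra | apply (log_dU _ _ _ _ hs) | apply (log_dU1 _ _ _ _ hs) | | lra | lra].
    intros s. rewrite rhs_uE, <- (heq s).
    replace (exp (U s) * (exp (U s) - 1) +
             (exp (U s) - exp (U s)) * (3 * exp (U s) + 2 * exp (U s) - 1))
      with (exp (U s) * (exp (U s) - exp 0)) by (rewrite exp_0; ring).
    destruct (both_nonpositive s) as [h _].
    assert (hl := exp_lipschitz (U s) 0 h (Rle_refl 0)). rewrite Rminus_0_r in hl.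
    assert (ha := exp_le_one _ h). assert (he := exp_pos (2 * s)).
    rewrite !Rabs_mult, !(Rabs_pos_eq (exp _)) by lra.
    assert (hp := Rabs_pos (exp (U s) - exp 0)).
    assert (exp (U s) * Rabs (exp (U s) - exp 0) <= 1 * Rabs (U s))
      by (apply Rmult_le_compat; lra).
    nra. }
  intros t. rewrite <- (heq t). split; apply hU.
Qed.

End Sign.

(** * Finite limits of the sum *)

Lemma is_lim_at_infinity (f : R -> R) (l : R) :
  is_lim f p_infty l <->
  (forall eps, 0 < eps -> exists T, forall t, T < t -> Rabs (f t - l) < eps).
Proof.
  split.
  - intros h eps heps. apply is_lim_spec in h. exact (h (mkposreal eps heps)).
  - intros h. apply is_lim_spec. intros eps. exact (h eps (cond_pos eps)).
Qed.

(** At c0 = max(2, 1/(2q)) repulsion holds weakly, 2 q c0 >= 1, while q(2 c0^2 - 6) < c0 is strict: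
    the slack c0 - q(2 c0^2 - 6) is 2 - 2q in one case and 6q in the other. A level slightly above
    c0 therefore makes both strict, with room for q to vary. *)
Lemma level_between_repulsion_and_balance (q : R) : 0 < q < 1 ->
  exists q1 q2 c, 0 < q1 < q /\ q < q2 < 1 /\ 2 < c /\ 1 < 2 * q1 * c /\
    q2 * (2 * c ^ 2 - 6) < c.
Proof.
  intros hq.
  set (c0 := Rmax 2 (/ (2 * q))).
  assert (h2 : 2 <= c0) by apply Rmax_l.
  assert (hc0 : 1 <= 2 * q * c0).
  { replace 1 with (2 * q * / (2 * q)) by (field; lra).
    apply Rmult_le_compat_l; [lra | apply Rmax_r]. }
  assert (hm : q * (2 * c0 ^ 2 - 6) < c0).
  { unfold c0, Rmax. destruct (Rle_dec 2 (/ (2 * q))); [ | nra].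
    replace (q * (2 * (/ (2 * q)) ^ 2 - 6)) with (/ (2 * q) - 6 * q) by (field; lra). lra. }
  (* [B] bounds the growth of (q + e)(2 (c0 + e)^2 - 6) per unit of e, for e <= 1, so the chosen e
     consumes at most half of the slack [m]. *)
  set (B := 2 * (c0 + 1) ^ 2 + q * (4 * c0 + 2)).
  assert (hB : 0 < B) by (unfold B; nra).
  set (m := c0 - q * (2 * c0 ^ 2 - 6)). assert (hm0 : 0 < m) by (unfold m; lra).
  set (e := Rmin (1 / 2) (Rmin ((1 - q) / 2) (m / (2 * B)))).
  assert (he : 0 < e /\ e <= 1 / 2 /\ e <= (1 - q) / 2 /\ e <= m / (2 * B)).
  { assert (0 < m / (2 * B)) by (apply Rdiv_lt_0_compat; lra).
    unfold e. repeat split.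
    - repeat apply Rmin_glb_lt; lra.
    - apply Rmin_l.
    - eapply Rle_trans; [apply Rmin_r | apply Rmin_l].
    - eapply Rle_trans; [apply Rmin_r | apply Rmin_r]. }
  destruct he as [he0 [he1 [he2 he3]]].
  assert (heB : e * B <= m / 2).
  { replace (m / 2) with (m / (2 * B) * B) by (field; lra).
    apply Rmult_le_compat_r; lra. }
  assert (hden : 0 < / (c0 + e / 2)) by (apply Rinv_0_lt_compat; lra).
  (* The loss factor c0 / (c0 + e/2) in q1 is outweighed by the gain from c0 to c0 + e, so 2 q1 c >
     2 q c0 >= 1. *)
  exists (q * c0 * / (c0 + e / 2)), (q + e), (c0 + e).
  assert (hfr : c0 * / (c0 + e / 2) < 1).
  { apply (Rmult_lt_reg_r (c0 + e / 2)); [lra | ].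
    rewrite Rmult_assoc, Rinv_l by lra. lra. }
  repeat split; try lra.
  - repeat apply Rmult_lt_0_compat; lra.
  - rewrite Rmult_assoc. nra.
  - replace (2 * (q * c0 * / (c0 + e / 2)) * (c0 + e))
      with ((2 * q * c0) * ((c0 + e) * / (c0 + e / 2))) by ring.
    assert (1 < (c0 + e) * / (c0 + e / 2)); [ | nra].
    apply (Rmult_lt_reg_r (c0 + e / 2)); [lra | ].
    rewrite Rmult_assoc, Rinv_l by lra. lra.
  - assert (q * (2 * (c0 + e) ^ 2) <= q * (2 * c0 ^ 2 + e * (4 * c0 + 2))).
    { apply Rmult_le_compat_l; nra. }
    assert (e * (2 * (c0 + e) ^ 2 - 6) <= e * (2 * (c0 + 1) ^ 2)).
    { apply Rmult_le_compat_l; nra. }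
    unfold m, B in *. nra.
Qed.

(* With q = exp((U+V)/2) and c = 2 cosh((U-V)/2) the forcing of U + V is
   q (q (2 c^2 - 6) - c), while c is driven away from 2 as soon as 2 q c > 1.
   If q has a limit in (0,1), the level above separates the two regimes: c must
   exceed it at some late time, and then it can never come back. *)
Lemma sum_limit_zero {U U1 V V1 : R -> R} (hs : log_system U U1 V V1) (sigma : R) :
  is_lim (fun t => U t + V t) p_infty sigma -> sigma = 0.
Proof.
  intros hlim. rewrite is_lim_at_infinity in hlim.
  assert (hle : sigma <= 0).
  { apply Rnot_lt_le. intros hp. destruct (hlim sigma hp) as [T hT].
    specialize (hT (T + 1) ltac:(lra)). apply Rabs_def2 in hT.
    assert (h := sum_nonpositive hs (T + 1)). lra. }
  destruct hle as [hneg | ]; [exfalso | assumption].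
  set (q := fun t => exp ((U t + V t) / 2)).
  set (x := fun t => exp ((U t - V t) / 2)).
  set (y := fun t => exp (- (U t - V t) / 2)).
  set (c := fun t => x t + y t).
  assert (hxy : forall t, x t * y t = 1).
  { intros t. unfold x, y. rewrite <- exp_plus, <- exp_0. f_equal. field. }
  assert (hpos : forall t, 0 < q t /\ 0 < x t /\ 0 < y t).
  { intros t. repeat split; apply exp_pos. }
  assert (hU : forall t, exp (U t) = q t * x t).
  { intros t. unfold q, x. rewrite <- exp_plus. f_equal. field. }
  assert (hV : forall t, exp (V t) = q t * y t).
  { intros t. unfold q, y. rewrite <- exp_plus. f_equal. field. }
  assert (hc2 : forall t, 2 <= c t).
  { intros t. destruct (hpos t) as [_ [h1 h2]]. specialize (hxy t).
    unfold c. assert (h := pow2_ge_0 (x t - y t)).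
    apply Rsqr_incr_0_var; [unfold Rsqr; nra | lra]. }
  set (qs := exp (sigma / 2)).
  assert (hqs : 0 < qs < 1).
  { split; [apply exp_pos | unfold qs; rewrite <- exp_0; apply exp_increasing; lra]. }
  destruct (level_between_repulsion_and_balance qs hqs)
    as [q1 [q2 [l [hq1 [hq2 [hl [hrep hbal]]]]]]].
  assert (hband : exists T, forall t, T <= t -> q1 <= q t <= q2 /\ sigma - 1 <= U t + V t).
  { assert (h1 : 2 * ln q1 < sigma).
    { assert (ln q1 < ln qs) by (apply ln_increasing; lra).
      unfold qs in H. rewrite ln_exp in H. lra. }
    assert (h2 : sigma < 2 * ln q2).
    { assert (ln qs < ln q2) by (apply ln_increasing; lra).
      unfold qs in H. rewrite ln_exp in H. lra. }
    set (e := Rmin 1 (Rmin (sigma - 2 * ln q1) (2 * ln q2 - sigma))).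
    assert (he : 0 < e) by (unfold e; repeat apply Rmin_glb_lt; lra).
    assert (e <= 1) by apply Rmin_l.
    assert (e <= sigma - 2 * ln q1) by (eapply Rle_trans; [apply Rmin_r | apply Rmin_l]).
    assert (e <= 2 * ln q2 - sigma) by (eapply Rle_trans; [apply Rmin_r | apply Rmin_r]).
    destruct (hlim e he) as [T hT]. exists (T + 1). intros t ht.
    specialize (hT t ltac:(lra)). apply Rabs_def2 in hT.
    split; [ | lra]. unfold q. split.
    - rewrite <- (exp_ln q1) by lra. left. apply exp_increasing. lra.
    - rewrite <- (exp_ln q2) by lra. left. apply exp_increasing. lra. }
  destruct hband as [T hT].
  set (D1 := fun t => U1 t - V1 t).
  set (c1 := fun t => D1 t / 2 * (x t - y t)).
  (* The second derivative of c: c' = (D'/2)(x - y), and xy = 1 gives (x - y)^2 = c^2 - 4. *)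
  set (c'' := fun t => 3 / 2 * exp (2 * t) * (q t * (c t ^ 2 - 4)) * (2 * q t * c t - 1)
                      + D1 t ^ 2 / 4 * c t).
  assert (hx : forall t : R, is_derive x t (D1 t / 2 * x t)).
  { intros t. assert (h2 := log_dU _ _ _ _ hs t). assert (h3 := log_dV _ _ _ _ hs t).
    unfold x, D1. derive_from_context. unfold Rminus, Rdiv. field. }
  assert (hy : forall t : R, is_derive y t (- (D1 t / 2) * y t)).
  { intros t. assert (h2 := log_dU _ _ _ _ hs t). assert (h3 := log_dV _ _ _ _ hs t).
    unfold y, D1. derive_from_context. unfold Rminus, Rdiv. field. }
  assert (hdc : forall t : R, is_derive c t (c1 t)).
  { intros t. unfold c, c1. assert (h2 := hx t). assert (h3 := hy t). derive_from_context. }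
  assert (hdc1 : forall t : R, is_derive c1 t (c'' t)).
  { intros t. assert (h1 := difference_derive2 hs t).
    assert (h2 := log_dU _ _ _ _ hs t). assert (h3 := log_dV _ _ _ _ hs t).
    change (is_derive (fun s => D1 s) t (exp (2 * t) * (3 * (exp (U t) - exp (V t)) *
      (2 * (exp (U t) + exp (V t)) - 1)))) in h1.
    rewrite hU, hV in h1.
    set (L := exp (2 * t) * (3 * (q t * x t - q t * y t) * (2 * (q t * x t + q t * y t) - 1))) in h1.
    assert (hx' := hx t). assert (hy' := hy t).
    clear h2 h3. change (is_derive D1 t L) in h1.
    unfold c1. derive_from_context.
    specialize (hxy t). unfold c'', L, c.
    replace ((x t + y t) ^ 2 - 4) with ((x t - y t) ^ 2) by nra. field. }
  assert (hsum : forall t, sum_rhs (exp (U t)) (exp (V t)) =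
            q t * (q t * (2 * c t ^ 2 - 6) - c t)).
  { intros t. rewrite hU, hV. unfold sum_rhs, c. specialize (hxy t).
    replace ((x t + y t) ^ 2) with ((x t + y t) ^ 2 + 3 * (x t * y t - 1)) by (rewrite hxy; ring).
    replace (q t * (q t * (2 * ((x t + y t) ^ 2 + 3 * (x t * y t - 1)) - 6) - (x t + y t)))
      with (q t * (q t * (2 * ((x t + y t) ^ 2) + 6 * (x t * y t) - 12 * (x t * y t)) - (x t + y t)))
      by (rewrite hxy; ring).
    field. }
  (* The expression q2 (2 c^2 - 6) - c is convex in c, so on [2, l] it is at most its larger
     endpoint value; [delta] is the smaller of the two gaps below 0. *)
  set (delta := Rmin (2 - 2 * q2) (l - q2 * (2 * l ^ 2 - 6))).
  assert (hd : 0 < delta /\ delta <= 2 - 2 * q2 /\ delta <= l - q2 * (2 * l ^ 2 - 6)).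
  { unfold delta. split; [apply Rmin_glb_lt; lra | split; [apply Rmin_l | apply Rmin_r]]. }
  assert (hexp : forall s t, s <= t -> 0 < exp (2 * s) <= exp (2 * t)).
  { intros s t hst. split; [apply exp_pos | apply exp_le; lra]. }
  assert (hexceed : forall T', T <= T' -> exists t, T' <= t /\ l < c t).
  { intros T' hT'. apply NNPP. intros hn.
    apply (uniformly_convex_unbounded (fun t => - (U t + V t)) (fun t => - (U1 t + V1 t))
      (fun t => - (exp (2 * t) * sum_rhs (exp (U t)) (exp (V t)))) T'
      (exp (2 * T') * (q1 * delta)) (1 - sigma)).
    - apply Rmult_lt_0_compat; [apply exp_pos | apply Rmult_lt_0_compat; lra].
    - intros t _. apply (is_derive_opp (fun s => U s + V s)), (sum_derive hs).
    - intros t _. apply (is_derive_opp (fun s => U1 s + V1 s)), (sum_derive2 hs).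
    - intros t ht. rewrite hsum, Ropp_mult_distr_r.
      assert (hcl : c t <= l) by (apply Rnot_lt_le; intros h; apply hn; exists t; auto).
      destruct (hT t ltac:(lra)) as [hq _]. specialize (hc2 t).
      assert (hk : q t * (2 * c t ^ 2 - 6) - c t <= - delta).
      { assert (q t * (2 * c t ^ 2 - 6) <= q2 * (2 * c t ^ 2 - 6))
          by (apply Rmult_le_compat_r; nra).
        assert (hch : 0 <= (c t - 2) * (l - c t)) by (apply Rmult_le_pos; lra).
        assert (q2 * (2 * c t ^ 2 - 6) <= q2 * (2 * ((2 + l) * c t - 2 * l) - 6)).
        { apply Rmult_le_compat_l; nra. }
        destruct (Rle_dec 0 (q2 * 2 * (2 + l) - 1)); nra. }
      destruct (hexp T' t ht).
      apply Rmult_le_compat; [lra | | lra | ].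
      + apply Rmult_le_pos; lra.
      + rewrite Ropp_mult_distr_r. apply Rmult_le_compat; lra.
    - intros t ht. destruct (hT t ltac:(lra)). lra. }
  assert (hconv : forall t, T <= t -> l <= c t ->
            3 / 2 * exp (2 * T) * (q1 * (l ^ 2 - 4)) * (2 * q1 * l - 1) <= c'' t).
  { intros t ht hlc. destruct (hT t ht) as [hq _]. specialize (hc2 t).
    destruct (hexp T t ht).
    assert (0 <= D1 t ^ 2 / 4 * c t).
    { apply Rmult_le_pos; [ | lra]. assert (h := pow2_ge_0 (D1 t)). lra. }
    unfold c''.
    enough (3 / 2 * exp (2 * T) * (q1 * (l ^ 2 - 4)) * (2 * q1 * l - 1) <=
            3 / 2 * exp (2 * t) * (q t * (c t ^ 2 - 4)) * (2 * q t * c t - 1)) by lra.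
    assert (q1 * l <= q t * c t) by (apply Rmult_le_compat; lra).
    apply Rmult_le_compat; [ | lra | | lra].
    - apply Rmult_le_pos; [lra | apply Rmult_le_pos; nra].
    - apply Rmult_le_compat; [lra | apply Rmult_le_pos; nra | lra | ].
      apply Rmult_le_compat; nra. }
  set (c3 := 3 / 2 * exp (2 * T) * (q1 * (l ^ 2 - 4)) * (2 * q1 * l - 1)) in *.
  assert (hc3 : 0 < c3).
  { unfold c3. assert (h := exp_pos (2 * T)).
    repeat apply Rmult_lt_0_compat; try lra. nra. }
  assert (hstay : exists T', T <= T' /\ forall t, T' <= t -> l <= c t).
  { destruct (classic (exists t3, T <= t3 /\ c t3 <= l)) as [[t3 [h3 h3']] | hn].
    - destruct (hexceed t3 h3) as [t4 [h4 h4']].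
      assert (h34 : t3 < t4).
      { destruct h4 as [h4 | <-]; [exact h4 | lra]. }
      destruct (upcrossing c c1 l t3 t4 h34 ltac:(auto) h3' h4') as [r [hr [hr1 hr2]]].
      exists r. split; [lra | ]. intros t ht.
      destruct (trapped_increasing c c1 c'' c c1 c'' r
        ltac:(auto) ltac:(auto) ltac:(auto) ltac:(auto)
        ltac:(intros s h5 h6 h7; specialize (hconv s ltac:(lra) ltac:(lra)); lra)
        ltac:(lra) ltac:(lra) t ht). lra.
    - exists T. split; [lra | ]. intros t ht. apply Rnot_lt_le. intros h.
      apply hn. exists t. lra. }
  destruct hstay as [T' [hT' hstay]].
  (* U, V <= 0 and U + V >= sigma - 1 bound |U - V| by 1 - sigma, hence c from above, against its
     uniform convexity. *)
  apply (uniformly_convex_unbounded c c1 c'' T' c3 (2 * exp ((2 - sigma) / 2))); auto.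
  - intros t ht. apply hconv; [lra | auto].
  - intros t ht. destruct (hT t ltac:(lra)) as [_ hlow].
    destruct (both_nonpositive hs t).
    assert (x t <= exp ((2 - sigma) / 2)) by (left; apply exp_increasing; lra).
    assert (y t <= exp ((2 - sigma) / 2)) by (left; apply exp_increasing; lra).
    unfold c. lra.
Qed.

(** * Critical points of the sum *)

Lemma sum_rhs_factor (a k : R) :
  sum_rhs a (a * k) = a * (2 * a * (1 - k + k ^ 2) - (1 + k)).
Proof. unfold sum_rhs. field. Qed.

(** Here k stands for b/a = e^(-(U - V)): as U and U - V grow, a rises and k falls. The bound 2 a0 >
    1 comes from (1 + k0) / (1 - k0 + k0^2) > 1 for 0 < k0 < 1. *)
Lemma sum_rhs_nonneg_persists (a0 k0 a k : R) :
  0 < k0 < 1 -> 0 < k <= k0 -> 0 < a0 <= a -> a <= 1 ->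
  0 <= sum_rhs a0 (a0 * k0) -> 1 < 2 * a0 /\ 0 <= sum_rhs a (a * k).
Proof.
  intros hk0 hk ha ha1 h0. rewrite sum_rhs_factor in *.
  assert (hpsi : 0 <= 2 * a0 * (1 - k0 + k0 ^ 2) - (1 + k0)).
  { apply Rnot_lt_le. intros h. nra. }
  split; [nra | ].
  (* in k the bracket at a0 is convex and at most 0 at k = 1, so it stays nonnegative left of k0 *)
  assert (hconv : (1 - k0) * (2 * a0 * (1 - k + k ^ 2) - (1 + k)) =
    (1 - k) * (2 * a0 * (1 - k0 + k0 ^ 2) - (1 + k0))
    + (k0 - k) * (2 - 2 * a0) + 2 * a0 * ((1 - k0) * (1 - k) * (k0 - k))) by ring.
  assert (h1 : 0 <= (1 - k) * (2 * a0 * (1 - k0 + k0 ^ 2) - (1 + k0))) by (apply Rmult_le_pos; lra).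
  assert (h2 : 0 <= (k0 - k) * (2 - 2 * a0)) by (apply Rmult_le_pos; lra).
  assert (h3 : 0 <= 2 * a0 * ((1 - k0) * (1 - k) * (k0 - k))).
  { repeat apply Rmult_le_pos; lra. }
  assert (h4 : 0 <= 2 * a0 * (1 - k + k ^ 2) - (1 + k)).
  { apply Rnot_lt_le. intros h. nra. }
  apply Rmult_le_pos; [lra | ].
  assert (0 <= (a - a0) * (1 - k + k ^ 2)) by (apply Rmult_le_pos; nra).
  lra.
Qed.

(* Under these conditions U and U - V are both convex and increasing from tau
   on, so U becomes positive. *)
Lemma no_joint_growth {U U1 V V1 : R -> R} (hs : log_system U U1 V V1) (tau : R) :
  V tau < U tau -> 0 <= U1 tau -> 0 <= U1 tau - V1 tau ->
  0 <= sum_rhs (exp (U tau)) (exp (V tau)) -> False.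
Proof.
  intros hD hU1 hD1 hH.
  set (a0 := exp (U tau)) in *.
  set (k0 := exp (- (U tau - V tau))).
  assert (hV : forall t, exp (V t) = exp (U t) * exp (- (U t - V t))).
  { intros t. rewrite <- exp_plus. f_equal. ring. }
  rewrite hV in hH. fold a0 k0 in hH.
  assert (hk0 : 0 < k0 < 1).
  { split; [apply exp_pos | ]. rewrite <- exp_0. apply exp_increasing. lra. }
  assert (ha0 : 0 < a0 <= 1) by (apply exp_le_one, (component_nonpositive hs)).
  (* [rhs_u] is half the sum of the forcings of U + V and U - V: the former stays nonnegative, the
     latter stays at least 3 a0 (1 - k0)(2 a0 - 1). *)
  set (c := 3 / 2 * (a0 * (1 - k0)) * (2 * a0 - 1)).
  assert (hc : 0 < c).
  { destruct (sum_rhs_nonneg_persists a0 k0 a0 k0) as [h _]; try lra.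
    unfold c. repeat apply Rmult_lt_0_compat; lra. }
  assert (hforce : forall t, tau <= t -> U tau <= U t -> U tau - V tau <= U t - V t ->
            exp (2 * tau) * c <= exp (2 * t) * rhs_u (U t) (V t) /\
            0 < exp (2 * t) * (3 * (exp (U t) - exp (V t)) *
                  (2 * (exp (U t) + exp (V t)) - 1))).
  { intros t ht h1 h2.
    assert (ha := exp_le _ _ h1). fold a0 in ha.
    assert (hk := exp_le (- (U t - V t)) (- (U tau - V tau)) ltac:(lra)). fold k0 in hk.
    assert (hkp := exp_pos (- (U t - V t))).
    assert (ha1 := exp_le_one _ (component_nonpositive hs t)).
    destruct (sum_rhs_nonneg_persists a0 k0 (exp (U t)) (exp (- (U t - V t))))
      as [h3 h4]; try lra.
    rewrite <- hV in h4.
    assert (h5 : a0 * (1 - k0) <= exp (U t) - exp (V t)).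
    { rewrite hV. replace (exp (U t) - exp (U t) * exp (- (U t - V t)))
        with (exp (U t) * (1 - exp (- (U t - V t)))) by ring.
      apply Rmult_le_compat; lra. }
    assert (h6 := exp_pos (V t)).
    assert (h7 : 0 < a0 * (1 - k0)) by (apply Rmult_lt_0_compat; lra).
    split.
    - apply Rmult_le_compat; [left; apply exp_pos | lra | apply exp_le; lra | ].
      assert (e1 := rhs_sum (U t) (V t)). assert (e2 := rhs_difference (U t) (V t)).
      assert (a0 * (1 - k0) * (2 * a0 - 1) <=
        (exp (U t) - exp (V t)) * (2 * (exp (U t) + exp (V t)) - 1)).
      { apply Rmult_le_compat; lra. }
      unfold c. lra.
    - assert (h8 := exp_pos (2 * t)). repeat apply Rmult_lt_0_compat; lra. }
  assert (hpos : 0 < exp (2 * tau) * c) by (apply Rmult_lt_0_compat; [apply exp_pos | lra]).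
  assert (tr := trapped_increasing U U1 (fun t => exp (2 * t) * rhs_u (U t) (V t))
    (fun s => U s - V s) (fun s => U1 s - V1 s)
    (fun t => exp (2 * t) * (3 * (exp (U t) - exp (V t)) * (2 * (exp (U t) + exp (V t)) - 1)))
    tau (fun t _ => log_dU _ _ _ _ hs t) (fun t _ => log_dU1 _ _ _ _ hs t)
    (fun t _ => difference_derive hs t) (fun t _ => difference_derive2 hs t)
    ltac:(intros t ht h1 h2; destruct (hforce t ht h1 h2); split; lra) hU1 hD1).
  apply (uniformly_convex_unbounded U U1 (fun t => exp (2 * t) * rhs_u (U t) (V t))
    tau (exp (2 * tau) * c) 0 hpos).
  - intros t _. apply (log_dU _ _ _ _ hs).
  - intros t _. apply (log_dU1 _ _ _ _ hs).
  - intros t ht. destruct (tr t ht) as [h1 [h2 _]]. apply hforce; assumption.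
  - intros t _. apply (component_nonpositive hs).
Qed.

(** Since (a - b)^2 < (a + b)^2, the forcing is below (a + b)(2(a + b) - 1). So wherever the sum is
    not pushed down, U - V is repelled from 0. *)
Lemma sum_rhs_nonneg_large_sum (a b : R) :
  0 < a -> 0 < b -> 0 <= sum_rhs a b -> 1 < 2 * (a + b).
Proof.
  intros ha hb h. unfold sum_rhs in h.
  assert ((a - b) ^ 2 < (a + b) ^ 2) by nra. nra.
Qed.

Lemma sum_rhs_diagonal (x : R) : x < 0 -> sum_rhs (exp x) (exp x) < 0.
Proof.
  intros h. assert (h1 := exp_pos x).
  assert (h2 : exp x < 1) by (rewrite <- exp_0; apply exp_increasing; lra).
  unfold sum_rhs. nra.
Qed.

Lemma sum_rhs_cosh (s d : R) :
  sum_rhs (exp ((s + d) / 2)) (exp ((s - d) / 2)) =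
  exp (s / 2) * (exp (s / 2) * (2 * (exp (d / 2) + exp (- (d / 2))) ^ 2 - 6)
                 - (exp (d / 2) + exp (- (d / 2)))).
Proof.
  replace ((s + d) / 2) with (s / 2 + d / 2) by field.
  replace ((s - d) / 2) with (s / 2 + - (d / 2)) by field.
  rewrite !exp_plus.
  assert (h : exp (d / 2) * exp (- (d / 2)) = 1) by (rewrite <- exp_plus, <- exp_0; f_equal; ring).
  set (x := exp (d / 2)) in *. set (y := exp (- (d / 2))) in *.
  unfold sum_rhs.
  replace 6 with (6 * (x * y)) by (rewrite h; ring). field.
Qed.

Lemma sum_rhs_pos_monotone (s0 d0 s d : R) :
  0 <= d0 -> d0 <= d -> s0 <= s ->
  0 < sum_rhs (exp ((s0 + d0) / 2)) (exp ((s0 - d0) / 2)) ->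
  0 < sum_rhs (exp ((s + d) / 2)) (exp ((s - d) / 2)).
Proof.
  intros hd0 hd hs h. rewrite sum_rhs_cosh in *.
  set (q0 := exp (s0 / 2)) in *. set (q := exp (s / 2)).
  set (c0 := exp (d0 / 2) + exp (- (d0 / 2))) in *.
  set (c := exp (d / 2) + exp (- (d / 2))).
  assert (hq0 : 0 < q0) by apply exp_pos.
  assert (hq : q0 <= q).
  { apply exp_le. lra. }
  assert (hc : 2 <= c0 <= c).
  { unfold c0, c.
    assert (hx : forall z, exp (z / 2) * exp (- (z / 2)) = 1).
    { intros z. rewrite <- exp_plus, <- exp_0. f_equal. ring. }
    assert (h1 := hx d0). assert (h2 := hx d).
    assert (h3 : 1 <= exp (d0 / 2)) by (assert (h3 := exp_ge_linear (d0 / 2)); lra).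
    assert (h4 : exp (d0 / 2) <= exp (d / 2)) by (apply exp_le; lra).
    set (x0 := exp (d0 / 2)) in *. set (x := exp (d / 2)) in *.
    set (y0 := exp (- (d0 / 2))) in *. set (y := exp (- (d / 2))) in *.
    assert (hy0 : 0 < y0) by apply exp_pos. assert (hy : 0 < y) by apply exp_pos.
    assert (hy0' : y0 <= 1) by nra.
    split; [nra | ].
    assert (e : (x + y - x0 - y0) = (x - x0) * (1 - y * y0)).
    { replace ((x - x0) * (1 - y * y0)) with (x - x0 - (x * y) * y0 + (x0 * y0) * y) by ring.
      rewrite h1, h2. ring. }
    assert (y <= 1) by nra.
    assert (0 <= (x - x0) * (1 - y * y0)) by (apply Rmult_le_pos; nra). lra. }
  assert (h1 : 0 < q0 * (2 * c0 ^ 2 - 6) - c0) by (apply Rnot_le_lt; intros hn; nra).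
  apply Rmult_lt_0_compat; [lra | ].
  assert (h2 : q0 * (2 * c ^ 2 - 6) <= q * (2 * c ^ 2 - 6)) by (apply Rmult_le_compat_r; nra).
  assert (h3 : 0 < q0 * (2 * c ^ 2 - 6) - c); [ | lra].
  (* Cross-multiplied monotonicity of 2c - 6/c; the forcing is positive exactly when q (2c - 6/c) >
     1. *)
  assert (h4 : c * (2 * c0 ^ 2 - 6) <= c0 * (2 * c ^ 2 - 6)).
  { assert (0 <= (c - c0) * (2 * (c * c0) + 6)) by (apply Rmult_le_pos; nra). nra. }
  assert (h5 : 0 < c0 * (q0 * (2 * c ^ 2 - 6) - c)); [ | apply Rnot_le_lt; intros hn; nra].
  assert (h6 : q0 * (c * (2 * c0 ^ 2 - 6)) <= q0 * (c0 * (2 * c ^ 2 - 6)))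
    by (apply Rmult_le_compat_l; lra).
  assert (h7 : 0 < c * (q0 * (2 * c0 ^ 2 - 6) - c0)) by (apply Rmult_lt_0_compat; lra).
  lra.
Qed.

Definition sum_forcing (U V : R -> R) (t : R) : R := sum_rhs (exp (U t)) (exp (V t)).

Lemma sum_forcing_swap (U V : R -> R) (t : R) : sum_forcing U V t = sum_forcing V U t.
Proof. unfold sum_forcing, sum_rhs. field. Qed.

Section Turning.
Context {U U1 V V1 : R -> R} (hs : log_system U U1 V V1).

Lemma sum_forcing_derive (t : R) :
  is_derive (sum_forcing U V) t
    (exp (U t) * U1 t * (4 * exp (U t) - 2 * exp (V t) - 1) +
     exp (V t) * V1 t * (4 * exp (V t) - 2 * exp (U t) - 1)).
Proof.
  assert (h1 := log_dU _ _ _ _ hs t). assert (h2 := log_dV _ _ _ _ hs t).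
  unfold sum_forcing, sum_rhs. derive_from_context. field.
Qed.

(* At such a point U - V would be decreasing; then h = sum_forcing stays
   positive all the way back, since going backward both U + V and U - V increase. *)
Lemma no_turning_point_ordered (t0 tau : R) :
  (forall t, U t + V t < 0) ->
  t0 <= tau -> sum_forcing U V t0 <= 0 -> 0 <= sum_forcing U V tau ->
  U1 tau + V1 tau = 0 ->
  (exists d, 0 < d /\ forall s, tau < s < tau + d -> 0 < U1 s + V1 s) ->
  V tau < U tau -> False.
Proof.
  intros hneg ht0 hH0 hH hS1 hafter hD.
  destruct (Rle_dec 0 (U1 tau - V1 tau)) as [hD1 | hD1].
  { apply (no_joint_growth hs tau); try assumption; lra. }
  apply Rnot_le_lt in hD1.
  assert (hlarge : forall t, 0 <= sum_forcing U V t -> 1 < 2 * (exp (U t) + exp (V t))).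
  { intros t. apply sum_rhs_nonneg_large_sum; apply exp_pos. }
  destruct (Rle_lt_or_eq_dec _ _ hH) as [hHp | hHz].
  - assert (hlt : t0 < tau).
    { destruct ht0 as [h | ->]; [exact h | lra]. }
    destruct (last_zero (sum_forcing U V) _ t0 tau hlt
      (fun t _ => sum_forcing_derive t) hH0 hHp) as [c [hc [hc0 hcp]]].
    assert (hHc : forall t, c <= t <= tau -> 0 <= sum_forcing U V t).
    { intros t ht. destruct (Req_dec t c) as [-> | hn]; [lra | left; apply hcp; lra]. }
    assert (hDp : forall t, c <= t <= tau -> 0 < U t - V t).
    { intros t ht. apply Rnot_le_lt. intros hn.
      assert (t < tau).
      { destruct (proj2 ht) as [h | ->]; [exact h | lra]. }
      destruct (last_zero (fun s => U s - V s) _ t tau H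
        (fun t _ => difference_derive hs t) hn ltac:(lra)) as [z [hz [hz0 _]]].
      assert (hHz := hHc z ltac:(lra)). unfold sum_forcing in hHz.
      replace (V z) with (U z) in hHz by lra.
      assert (hd := sum_rhs_diagonal (U z)). specialize (hneg z). lra. }
    assert (hD1c : forall t, c <= t <= tau -> U1 t - V1 t < 0).
    { intros t ht. eapply Rle_lt_trans; [ | exact hD1].
      apply (nondecreasing (fun s => U1 s - V1 s) _ t tau (proj2 ht)
        (fun t _ => difference_derive2 hs t)).
      intros s hs'. specialize (hDp s ltac:(lra)). specialize (hlarge s (hHc s ltac:(lra))).
      assert (exp (V s) < exp (U s)) by (apply exp_increasing; lra).
      assert (he := exp_pos (2 * s)). left. repeat apply Rmult_lt_0_compat; lra. }
    assert (hS1c : forall t, c <= t <= tau -> U1 t + V1 t <= 0).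
    { intros t ht. rewrite <- hS1.
      apply (nondecreasing (fun s => U1 s + V1 s) _ t tau (proj2 ht)
        (fun t _ => sum_derive2 hs t)).
      intros s hs'. apply Rmult_le_pos; [left; apply exp_pos | apply (hHc s); lra]. }
    assert (hSmon : U tau + V tau <= U c + V c).
    { assert (h := nondecreasing (fun s => - (U s + V s)) (fun s => - (U1 s + V1 s)) c tau
        ltac:(lra) (fun t _ => is_derive_opp _ t _ (sum_derive hs t))
        ltac:(intros s hs'; specialize (hS1c s ltac:(lra)); lra)). cbv beta in h. lra. }
    assert (hDmon : U tau - V tau <= U c - V c).
    { assert (h := nondecreasing (fun s => - (U s - V s)) (fun s => - (U1 s - V1 s)) c tau
        ltac:(lra) (fun t _ => is_derive_opp _ t _ (difference_derive hs t))
        ltac:(intros s hs'; specialize (hD1c s ltac:(lra)); lra)). cbv beta in h. lra. }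
    assert (h := sum_rhs_pos_monotone (U tau + V tau) (U tau - V tau) (U c + V c) (U c - V c)
      ltac:(lra) hDmon hSmon).
    replace ((U tau + V tau + (U tau - V tau)) / 2) with (U tau) in h by field.
    replace ((U tau + V tau - (U tau - V tau)) / 2) with (V tau) in h by field.
    replace ((U c + V c + (U c - V c)) / 2) with (U c) in h by field.
    replace ((U c + V c - (U c - V c)) / 2) with (V c) in h by field.
    unfold sum_forcing in *. specialize (h hHp). lra.
  (* Borderline case: V' = -U' and U' < 0 at tau give the forcing the derivative U' (a - b)(4(a + b)
     - 1) < 0. It is negative just after tau, so U' + V' could not become positive there. *)
  - assert (hlg := hlarge tau hH).
    assert (hab : exp (V tau) < exp (U tau)) by (apply exp_increasing; lra).
    assert (hder := is_derive_opp _ _ _ (sum_forcing_derive tau)).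
    assert (hpos : 0 < - (exp (U tau) * U1 tau * (4 * exp (U tau) - 2 * exp (V tau) - 1) +
                      exp (V tau) * V1 tau * (4 * exp (V tau) - 2 * exp (U tau) - 1))).
    { replace (V1 tau) with (- U1 tau) by lra.
      replace (- _) with (- U1 tau * ((exp (U tau) - exp (V tau)) *
         (4 * (exp (U tau) + exp (V tau)) - 1))) by ring.
      repeat apply Rmult_lt_0_compat; lra. }
    destruct (derive_sign_near _ _ _ hder hpos) as [e [he hne]].
    destruct hafter as [d [hd hafter]].
    set (m := Rmin e d / 2).
    assert (hm : 0 < m /\ m < e /\ m < d).
    { assert (0 < Rmin e d) by (apply Rmin_glb_lt; assumption).
      assert (Rmin e d <= e) by apply Rmin_l. assert (Rmin e d <= d) by apply Rmin_r.
      unfold m. lra. }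
    specialize (hafter (tau + m) ltac:(lra)).
    destruct (mean_value (fun s => U1 s + V1 s) _ tau (tau + m) ltac:(lra)
      (fun t _ => sum_derive2 hs t)) as [z [hz e1]].
    specialize (hne z ltac:(lra)). cbv beta in hne, e1.
    change (opp (sum_forcing U V tau)) with (- sum_forcing U V tau) in hne.
    change (opp (sum_forcing U V z)) with (- sum_forcing U V z) in hne.
    fold (sum_forcing U V z) in e1.
    assert (exp (2 * z) * sum_forcing U V z < 0).
    { assert (h := exp_pos (2 * z)). nra. }
    nra.
Qed.

End Turning.

(** [no_turning_point_ordered] traces the forcing back to a zero, so the starting time needs
    nonpositive slope and nonpositive forcing of the sum together. *)
Lemma sum_nonincreasing_after {U U1 V V1 : R -> R} (hs : log_system U U1 V V1) (t1 : R) :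
  (forall t, U t + V t < 0) -> U1 t1 + V1 t1 <= 0 ->
  exists t0, forall t, t0 <= t -> U1 t + V1 t <= 0.
Proof.
  intros hneg h1.
  assert (hstart : exists t0, U1 t0 + V1 t0 <= 0 /\ sum_forcing U V t0 <= 0).
  { destruct (Rle_dec (sum_forcing U V t1) 0) as [h | h]; [exists t1; auto | ].
    apply Rnot_le_lt in h.
    destruct (classic (exists t, t < t1 /\ sum_forcing U V t <= 0)) as [[t [ht ht']] | hn].
    - destruct (last_zero (sum_forcing U V) _ t t1 ht
        (fun t _ => sum_forcing_derive hs t) ht' h) as [c [hc [hc0 hcp]]].
      exists c. split; [ | lra]. eapply Rle_trans; [ | exact h1].
      apply (nondecreasing (fun s => U1 s + V1 s) _ c t1 ltac:(lra)
        (fun t _ => sum_derive2 hs t)).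
      intros s hs'. apply Rmult_le_pos; [left; apply exp_pos | left; apply (hcp s); lra].
    (* With positive forcing on the whole past, the slope of the sum would be below -k before t1 -
       1, and the sum would be positive at time x. *)
    - exfalso.
      assert (hpos : forall t, t < t1 -> 0 < sum_forcing U V t).
      { intros t ht. apply Rnot_le_lt. intros h'. apply hn. exists t. auto. }
      assert (hmon : forall s t, s < t <= t1 -> U1 s + V1 s < U1 t + V1 t).
      { intros s t hst.
        apply (strictly_increasing (fun s => U1 s + V1 s) _ s t ltac:(lra)
          (fun t _ => sum_derive2 hs t)).
        intros x hx. apply Rmult_lt_0_compat; [apply exp_pos | apply (hpos x); lra]. }
      assert (h2 := hmon (t1 - 1) t1 ltac:(lra)).
      set (k := - (U1 (t1 - 1) + V1 (t1 - 1))). assert (hk : 0 < k) by (unfold k; lra).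
      set (S0 := U (t1 - 1) + V (t1 - 1)). assert (hS0 : S0 < 0) by apply hneg.
      set (x := t1 - 1 + S0 / k).
      assert (hx : S0 / k < 0).
      { unfold Rdiv. assert (h3 := Rinv_0_lt_compat k hk). nra. }
      destruct (mean_value (fun s => U s + V s) _ x (t1 - 1) ltac:(unfold x; lra)
        (fun t _ => sum_derive hs t)) as [c [hc e]]. cbv beta in e.
      specialize (hmon c (t1 - 1) ltac:(lra)). specialize (hneg x). fold S0 in e.
      assert (k * (t1 - 1 - x) = - S0) by (unfold x; field; lra).
      assert (0 < t1 - 1 - x) by (unfold x; lra).
      assert (U1 c + V1 c < - k) by (unfold k; lra). nra. }
  destruct hstart as [t0 [h0 hH0]].
  exists t0. intros t ht. apply Rnot_lt_le. intros hp.
  assert (hlt : t0 < t).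
  { destruct ht as [ht | <-]; [exact ht | lra]. }
  destruct (last_zero (fun s => U1 s + V1 s) _ t0 t hlt
    (fun t _ => sum_derive2 hs t) h0 hp) as [tau [htau [hz hafter]]].
  cbv beta in hz.
  assert (hafter' : exists d, 0 < d /\ forall s, tau < s < tau + d -> 0 < U1 s + V1 s).
  { exists (t - tau). split; [lra | ]. intros s hs'. apply hafter. lra. }
  assert (hH : 0 <= sum_forcing U V tau).
  { apply Rnot_lt_le. intros hn.
    assert (hd := is_derive_opp _ _ _ (sum_derive2 hs tau)).
    assert (he := exp_pos (2 * tau)).
    destruct (derive_sign_near _ _ _ hd) as [e [he' hne]].
    { change (0 < - (exp (2 * tau) * sum_forcing U V tau)). nra. }
    destruct hafter' as [d [hd' hafter']].
    set (m := Rmin e d / 2).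
    assert (hm : 0 < m /\ m < e /\ m < d).
    { assert (0 < Rmin e d) by (apply Rmin_glb_lt; assumption).
      assert (Rmin e d <= e) by apply Rmin_l. assert (Rmin e d <= d) by apply Rmin_r.
      unfold m. lra. }
    specialize (hne (tau + m) ltac:(lra)). specialize (hafter' (tau + m) ltac:(lra)).
    change (- (U1 tau + V1 tau) < - (U1 (tau + m) + V1 (tau + m))) in hne. lra. }
  destruct (Rtotal_order (U tau) (V tau)) as [h | [h | h]].
  - apply (no_turning_point_ordered (log_system_swap _ _ _ _ hs) t0 tau);
      [intros s; rewrite Rplus_comm; apply hneg | lra | rewrite sum_forcing_swap; exact hH0
      | rewrite sum_forcing_swap; exact hH | lra | | exact h].
    destruct hafter' as [d [hd h']]. exists d. split; [exact hd | ].
    intros s hs'. rewrite Rplus_comm. apply h', hs'.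
  - unfold sum_forcing in hH. rewrite <- h in hH.
    assert (hdg := sum_rhs_diagonal (U tau)). specialize (hneg tau). lra.
  - apply (no_turning_point_ordered hs t0 tau); try assumption. lra.
Qed.

(** * Divergent sum *)

(** For b = 0 the forcing is 2a(2a - 1). The factorization keeps the factor 2a - 1 and leaves b(1/2
    - 2b), a positive push while b is small. *)
Lemma rhs_u_lower (x y : R) :
  1 / 2 <= exp x -> exp y <= 1 / 8 ->
  (2 * exp x - 1) / 2 + exp y / 4 <= rhs_u x y.
Proof.
  intros ha hb. assert (hp := exp_pos y). rewrite rhs_uE.
  set (a := exp x) in *. set (b := exp y) in *.
  replace (a * (a - 1) + (a - b) * (3 * a + 2 * b - 1))
    with ((2 * a - 1) * (2 * a - b / 2) + b * (1 / 2 - 2 * b)) by field.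
  assert ((2 * a - 1) * (1 / 2) <= (2 * a - 1) * (2 * a - b / 2))
    by (apply Rmult_le_compat_l; lra).
  assert (b * (1 / 4) <= b * (1 / 2 - 2 * b)) by (apply Rmult_le_compat_l; lra).
  lra.
Qed.

Lemma rhs_v_lower (x y : R) :
  1 / 2 <= exp x <= 1 -> exp y <= 1 / 8 ->
  - (2 * exp x - 1) - 3 * exp y <= rhs_v x y.
Proof.
  intros ha hb. assert (hp := exp_pos y). rewrite rhs_swap, rhs_uE.
  set (a := exp x) in *. set (b := exp y) in *. nra.
Qed.

Lemma neg_exp_small (k eps : R) : 0 < eps -> 0 <= k ->
  forall t, 0 <= t -> k / eps <= t -> k * exp (- t) < eps.
Proof.
  intros he hk t ht hkt.
  assert (h := exp_ge_linear t).
  assert (hp := exp_pos (- t)).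
  assert (hi : exp t * exp (- t) = 1) by (rewrite <- exp_plus, <- exp_0; f_equal; ring).
  assert (k <= t * eps).
  { replace k with (k / eps * eps) by (field; lra). apply Rmult_le_compat_r; lra. }
  assert (k < exp t * eps) by nra.
  replace eps with (exp t * eps * exp (- t)).
  - apply Rmult_lt_compat_r; assumption.
  - replace (exp t * eps * exp (- t)) with (exp t * exp (- t) * eps) by ring.
    rewrite hi. ring.
Qed.

Section Decay.
Context {U U1 V V1 : R -> R} (hs : log_system U U1 V V1).

(* V' stays bounded below because V + 12 U is convex, so e^V and with it the
   forcing of y = U - log(1/2) decay at most exponentially in t; the restoring
   force e^(2t) y however makes y decay faster than every exponential. *)
Lemma no_decay_to_half_from_above (T : R) :
  (forall t, T <= t -> 1 / 2 <= exp (U t)) ->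
  (forall t, T <= t -> exp (V t) <= 1 / 8) ->
  (forall t, T <= t -> U1 t <= 0) -> False.
Proof.
  intros ha hb hU1.
  assert (hl : exp (ln (1 / 2)) = 1 / 2) by (apply exp_ln; lra).
  set (l := ln (1 / 2)) in *.
  assert (hUl : forall t, T <= t -> l <= U t).
  { intros t ht. apply Rnot_lt_le. intros h. apply exp_increasing in h.
    specialize (ha t ht). lra. }
  set (f := fun t => rhs_u (U t) (V t)).
  assert (hf : forall t, T <= t -> (2 * exp (U t) - 1) / 2 + exp (V t) / 4 <= f t).
  { intros t ht. apply rhs_u_lower; [apply ha | apply hb]; exact ht. }
  assert (hU0 := component_nonpositive hs).
  set (m := Rmax 1 (- (V1 T + 12 * U1 T))).
  assert (hm1 : 1 <= m) by apply Rmax_l.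
  assert (hm2 : - m <= V1 T + 12 * U1 T).
  { assert (h := Rmax_r 1 (- (V1 T + 12 * U1 T))). fold m in h. lra. }
  assert (hV1 : forall t, T <= t -> - m <= V1 t).
  { intros t ht.
    (* The factor 12 turns e^V / 4 from [rhs_u_lower] into 3 e^V, cancelling the loss in
       [rhs_v_lower]; the remaining terms add up to 5 (2 e^U - 1) >= 0. *)
    assert (h := nondecreasing (fun s => V1 s + 12 * U1 s)
      (fun s => exp (2 * s) * (rhs_v (U s) (V s) + 12 * f s)) T t ht).
    cbv beta in h. specialize (hU1 t ht).
    enough (V1 T + 12 * U1 T <= V1 t + 12 * U1 t) by lra. apply h.
    - intros s _. assert (h1 := log_dU1 _ _ _ _ hs s). assert (h2 := log_dV1 _ _ _ _ hs s).
      derive_from_context. unfold f. ring.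
    - intros s hs'. apply Rmult_le_pos; [left; apply exp_pos | ].
      specialize (hf s ltac:(lra)). specialize (ha s ltac:(lra)). specialize (hb s ltac:(lra)).
      assert (h1 := exp_le_one _ (hU0 s)).
      assert (h2 := rhs_v_lower (U s) (V s) ltac:(lra) hb). lra. }
  assert (hVlow : forall t, T <= t -> V T + m * T - m * t <= V t).
  { intros t ht.
    assert (h := nondecreasing (fun s => V s + m * s) (fun s => V1 s + m) T t ht).
    cbv beta in h. enough (V T + m * T <= V t + m * t) by lra. apply h.
    - intros s _. assert (h1 := log_dV _ _ _ _ hs s). derive_from_context.
    - intros s hs'. specialize (hV1 s ltac:(lra)). lra. }
  (* One more than the exponent m of the lower barrier, so that C e^(-kt) finally drops below it.
     From t >= k^2 on, e^(2t) >= 2 k^2, so the restoring force e^(2t) y / 2 supports the rate k. *)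
  set (k := m + 1).
  set (T2 := Rmax T (k * k)).
  assert (hT2 : T <= T2 /\ k * k <= T2) by (split; [apply Rmax_l | apply Rmax_r]).
  assert (hT2p : 0 <= T2) by (assert (0 <= k * k) by (unfold k; nra); lra).
  assert (hdy : forall t, is_derive (fun s => U s - l) t (U1 t)).
  { intros t. assert (h1 := log_dU _ _ _ _ hs t). derive_from_context. }
  set (C := (U T2 - l) * exp (k * T2)).
  assert (hC : 0 <= C).
  { apply Rmult_le_pos; [specialize (hUl T2 ltac:(lra)); lra | left; apply exp_pos]. }
  assert (hupper : forall t, T2 <= t -> U t - l <= C * exp (- (k * t))).
  { intros t ht.
    enough (U t - l - C * exp (- (k * t)) <= 0) by lra.
    apply (half_line_max_principle (fun s => U s - l - C * exp (- (k * s)))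
      (fun s => U1 s + k * C * exp (- (k * s)))
      (fun s => exp (2 * s) * f s - k * k * (C * exp (- (k * s)))) T2 (- l)).
    - intros s _. assert (h1 := log_dU _ _ _ _ hs s). derive_from_context.
    - intros s _. assert (h1 := log_dU1 _ _ _ _ hs s). derive_from_context. unfold f. ring.
    - intros s hs' hz. specialize (hf s ltac:(lra)). assert (hbp := exp_pos (V s)).
      assert (hlin := exp_ge_linear (U s - l)).
      assert (hexp : exp (U s) = 1 / 2 * exp (U s - l)).
      { rewrite <- hl, <- exp_plus. f_equal. ring. }
      assert (hfl : (U s - l) / 2 <= f s) by lra.
      assert (he := exp_ge_linear (2 * s)).
      assert (hUs := hUl s ltac:(lra)).
      assert (2 * (k * k) * ((U s - l) / 2) <= exp (2 * s) * f s).
      { apply Rmult_le_compat; try lra. assert (0 <= k * k) by (unfold k; nra). lra. }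
      assert (0 < k * k) by (unfold k; nra).
      assert (k * k * (C * exp (- (k * s))) < k * k * (U s - l))
        by (apply Rmult_lt_compat_l; lra). lra.
    - unfold C. rewrite Rmult_assoc, <- exp_plus.
      replace (k * T2 + - (k * T2)) with 0 by ring. rewrite exp_0. lra.
    - intros s _. specialize (hU0 s).
      assert (0 <= C * exp (- (k * s))) by (apply Rmult_le_pos; [exact hC | left; apply exp_pos]).
      lra.
    - exact ht. }
  (* Chosen so that kap e^(-mt) has as second derivative the lower bound for e^V / 4 given by
     [hVlow]. Then y - kap e^(-mt) is convex and bounded above, hence nonincreasing. *)
  set (kap := exp (V T + m * T) / (4 * (m * m))).
  assert (hkap : 0 < kap).
  { apply Rdiv_lt_0_compat; [apply exp_pos | nra]. }
  set (p := fun s => U s - l - kap * exp (- (m * s))).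
  assert (hdp : forall s : R, is_derive p s (U1 s + m * kap * exp (- (m * s)))).
  { intros s. assert (h1 := log_dU _ _ _ _ hs s). unfold p. derive_from_context. }
  assert (hp' : forall t, T2 <= t -> U1 t + m * kap * exp (- (m * t)) <= 0).
  { apply (convex_bounded_nonincreasing p (fun s => U1 s + m * kap * exp (- (m * s)))
      (fun s => exp (2 * s) * f s - m * m * (kap * exp (- (m * s)))) T2 (- l)).
    - intros s _. apply hdp.
    - intros s _. assert (h1 := log_dU1 _ _ _ _ hs s). derive_from_context. unfold f. ring.
    - intros s hs'. specialize (hf s ltac:(lra)). specialize (ha s ltac:(lra)).
      assert (h1 := exp_le _ _ (hVlow s ltac:(lra))).
      unfold Rminus in h1. rewrite exp_plus in h1.
      assert (h2 : m * m * (kap * exp (- (m * s))) = exp (V T + m * T) * exp (- (m * s)) / 4).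
      { unfold kap. field. lra. }
      assert (he := exp_ge_linear (2 * s)).
      assert (1 * (exp (V s) / 4) <= exp (2 * s) * f s).
      { assert (hbp := exp_pos (V s)). apply Rmult_le_compat; lra. }
      lra.
    - intros s _. unfold p. specialize (hU0 s).
      assert (0 < kap * exp (- (m * s))) by (apply Rmult_lt_0_compat; [exact hkap | apply exp_pos]).
      lra. }
  assert (hpmon : forall s t, T2 <= s <= t -> p t <= p s).
  { intros s t hst.
    assert (h := nondecreasing (fun s => - p s) (fun s => - (U1 s + m * kap * exp (- (m * s)))) s t
      ltac:(lra) (fun t _ => is_derive_opp _ t _ (hdp t))
      ltac:(intros x hx; specialize (hp' x ltac:(lra)); lra)). cbv beta in h. lra. }
  set (t3 := Rmax T2 (C / kap)).
  assert (ht3 : T2 <= t3 /\ C / kap <= t3) by (split; [apply Rmax_l | apply Rmax_r]).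
  assert (hp3 : p t3 < 0).
  { assert (h1 := neg_exp_small C kap hkap hC t3 ltac:(lra) ltac:(lra)).
    assert (h2 := hupper t3 ltac:(lra)).
    replace (- (k * t3)) with (- t3 + - (m * t3)) in h2 by (unfold k; ring).
    rewrite exp_plus in h2. assert (h3 := exp_pos (- (m * t3))).
    unfold p. nra. }
  (* From t3 on, p stays at most p(t3) < 0; but y >= 0 gives p >= -kap e^(-mt), which tends to 0. *)
  set (t4 := Rmax t3 (kap / - p t3)).
  assert (ht4 : t3 <= t4 /\ kap / - p t3 <= t4) by (split; [apply Rmax_l | apply Rmax_r]).
  assert (h1 := neg_exp_small kap (- p t3) ltac:(lra) ltac:(lra) t4 ltac:(lra) ltac:(lra)).
  assert (h2 := hpmon t3 t4 ltac:(lra)).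
  assert (h3 := hUl t4 ltac:(lra)).
  assert (h4 : exp (- (m * t4)) <= exp (- t4)) by (apply exp_le; nra).
  assert (h5 : kap * exp (- (m * t4)) <= kap * exp (- t4)) by (apply Rmult_le_compat_l; lra).
  unfold p at 1 in h2. lra.
Qed.

Lemma eventually_below_half :
  (forall B, exists T, forall t, T <= t -> U t + V t <= B) ->
  exists T, forall t, T <= t -> U t < ln (1 / 2).
Proof.
  intros hS.
  assert (hl : exp (ln (1 / 2)) = 1 / 2) by (apply exp_ln; lra).
  set (l := ln (1 / 2)) in *.
  assert (hU0 := component_nonpositive hs).
  (* With e^(U + V) <= 1/16, e^U >= 1/2 forces e^V <= 1/8, the range of [rhs_u_lower]. *)
  destruct (hS (ln (1 / 16))) as [T hT].
  assert (hb : forall t, T <= t -> l <= U t -> 1 / 2 <= exp (U t) /\ exp (V t) <= 1 / 8).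
  { intros t ht hu. apply exp_le in hu. rewrite hl in hu.
    specialize (hT t ht). apply exp_le in hT. rewrite exp_plus, exp_ln in hT by lra.
    assert (h := exp_pos (V t)). split; [lra | nra]. }
  assert (hforce : forall t, T <= t -> l <= U t ->
    0 < exp (2 * t) * rhs_u (U t) (V t)).
  { intros t ht hu. destruct (hb t ht hu) as [h1 h2].
    assert (h3 := rhs_u_lower _ _ h1 h2). assert (h4 := exp_pos (V t)).
    apply Rmult_lt_0_compat; [apply exp_pos | lra]. }
  assert (hA : forall t, T <= t -> l <= U t -> U1 t < 0).
  { intros t ht hu. apply Rnot_le_lt. intros hp.
    assert (tr := trapped_increasing U U1 (fun t => exp (2 * t) * rhs_u (U t) (V t))
      U U1 (fun t => exp (2 * t) * rhs_u (U t) (V t)) t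
      (fun t _ => log_dU _ _ _ _ hs t) (fun t _ => log_dU1 _ _ _ _ hs t)
      (fun t _ => log_dU _ _ _ _ hs t) (fun t _ => log_dU1 _ _ _ _ hs t)
      ltac:(intros s hs' h1 h2; split; apply hforce; lra) hp hp).
    assert (hinc : forall s, t < s -> 0 < U1 s).
    { intros s hts. eapply Rle_lt_trans; [exact hp | ].
      apply (strictly_increasing U1 _ t s hts (fun t _ => log_dU1 _ _ _ _ hs t)).
      intros x hx. destruct (tr x ltac:(lra)). apply hforce; lra. }
    (* At t itself e^U may equal 1/2, where the term (2 e^U - 1)/2 of the lower bound vanishes; one
       unit later it is positive. *)
    assert (hU1' : U t < U (t + 1)).
    { apply (strictly_increasing U U1); [lra | intros; apply (log_dU _ _ _ _ hs) | ].
      intros x hx. apply hinc. lra. }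
    assert (ha1 : 1 / 2 < exp (U (t + 1))) by (rewrite <- hl; apply exp_increasing; lra).
    apply (uniformly_convex_unbounded U U1 (fun t => exp (2 * t) * rhs_u (U t) (V t))
      (t + 1) (exp (2 * t) * ((2 * exp (U (t + 1)) - 1) / 2)) 0).
    - apply Rmult_lt_0_compat; [apply exp_pos | lra].
    - intros s _. apply (log_dU _ _ _ _ hs).
    - intros s _. apply (log_dU1 _ _ _ _ hs).
    - intros s hs'.
      assert (hmon : U (t + 1) <= U s).
      { apply (nondecreasing U U1); [lra | intros; apply (log_dU _ _ _ _ hs) | ].
        intros x hx. left. apply hinc. lra. }
      destruct (hb s ltac:(lra) ltac:(lra)) as [h1 h2].
      assert (h3 := rhs_u_lower _ _ h1 h2). assert (h4 := exp_pos (V s)).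
      assert (h5 := exp_le _ _ hmon).
      apply Rmult_le_compat; [left; apply exp_pos | lra | apply exp_le; lra | lra].
    - intros s _. apply hU0. }
  (* Once below log(1/2), U cannot return, since it would arrive with nonnegative slope. If it never
     gets below, it decreases forever, which [no_decay_to_half_from_above] excludes. *)
  destruct (classic (exists t2, T <= t2 /\ U t2 < l)) as [[t2 [h2 h2']] | hn].
  - exists t2. apply (real_induction (fun t => U t < l)); [exact h2' | | ].
    + intros t ht hlt. specialize (hlt t ltac:(lra)).
      destruct (derive_continuous U _ t (log_dU _ _ _ _ hs t) (l - U t) ltac:(lra))
        as [d [hd hc]].
      exists d. split; [exact hd | ]. intros s hs'.
      specialize (hc s). rewrite Rabs_pos_eq in hc by lra. specialize (hc ltac:(lra)).
      apply Rabs_def2 in hc. lra.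
    + intros t ht hlt. apply Rnot_le_lt. intros hge.
      assert (h := left_increasing_derive U _ t t2 (log_dU _ _ _ _ hs t) ht
        ltac:(intros s hs'; specialize (hlt s hs'); lra)).
      specialize (hA t ltac:(lra) hge). lra.
  - exfalso.
    assert (hge : forall t, T <= t -> l <= U t).
    { intros t ht. apply Rnot_lt_le. intros h. apply hn. exists t. auto. }
    apply (no_decay_to_half_from_above T).
    + intros t ht. apply hb; auto.
    + intros t ht. apply hb; auto.
    + intros t ht. left. apply hA; auto.
Qed.

End Decay.

(** * Topological solutions *)

Lemma vanishing_lower_bound (f : R -> R) (eps : R) :
  0 < eps -> is_lim f p_infty 0 -> exists T, forall t, T <= t -> - eps < f t.
Proof.
  intros he h. rewrite is_lim_at_infinity in h. destruct (h eps he) as [T hT].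
  exists (T + 1). intros t ht. specialize (hT t ltac:(lra)). apply Rabs_def2 in hT. lra.
Qed.

Section Topological.
Context {U U1 V V1 : R -> R} (hs : log_system U U1 V V1).
Context (hU : is_lim U p_infty 0) (hV : is_lim V p_infty 0).

(** The margin 1/20 keeps e^U and e^V above 19/20, so that the repulsion factor of U - V, 9 in the
    limit, stays above 25/4, the square of the rate 5/2. *)
Lemma both_near_zero :
  exists T, forall t, T <= t -> - (1 / 20) < U t /\ - (1 / 20) < V t.
Proof.
  destruct (vanishing_lower_bound U (1 / 20) ltac:(lra) hU) as [T1 h1].
  destruct (vanishing_lower_bound V (1 / 20) ltac:(lra) hV) as [T2 h2].
  exists (Rmax T1 T2). intros t ht.
  split; [apply h1 | apply h2]; eapply Rle_trans; try exact ht; [apply Rmax_l | apply Rmax_r].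
Qed.

(** Late, U - V is repelled from 0, so its square is convex; being bounded it is nonincreasing, and
    one zero makes U and V agree from then on. [identical_of_contact] extends this to all times. *)
Lemma late_contact_identical :
  exists T, forall t2, T <= t2 -> U t2 = V t2 -> forall t, U t = V t.
Proof.
  destruct both_near_zero as [T hT]. exists T. intros t2 ht2 heq.
  set (D := fun t => U t - V t). set (D1 := fun t => U1 t - V1 t).
  set (D2 := fun t => exp (2 * t) * (3 * (exp (U t) - exp (V t)) * (2 * (exp (U t) + exp (V t)) - 1))).
  assert (hD : forall t : R, is_derive D t (D1 t)) by apply (difference_derive hs).
  assert (hD1 : forall t : R, is_derive D1 t (D2 t)) by apply (difference_derive2 hs).
  assert (hsq : forall t, T <= t -> 2 * D t * D1 t <= 0).
  { apply (convex_bounded_nonincreasing (fun t => D t ^ 2) (fun t => 2 * D t * D1 t)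
      (fun t => 2 * D1 t ^ 2 + 2 * (D t * D2 t)) T 1).
    - intros t _. assert (h1 := hD t). derive_from_context.
    - intros t _. assert (h1 := hD t). assert (h2 := hD1 t). derive_from_context.
    - intros t ht. destruct (hT t ht) as [h1 h2].
      assert (h3 := exp_ge_linear (U t)). assert (h4 := exp_ge_linear (V t)).
      assert (h5 : 0 <= D t * (exp (U t) - exp (V t))).
      { unfold D. destruct (Rle_dec (V t) (U t)) as [h | h].
        - assert (h5 := exp_le _ _ h). apply Rmult_le_pos; lra.
        - assert (h5 := exp_le (U t) (V t) ltac:(lra)). nra. }
      assert (h6 : 0 <= D t * D2 t).
      { unfold D2.
        replace (D t * _) with (exp (2 * t) * (3 * (D t * (exp (U t) - exp (V t))) *
          (2 * (exp (U t) + exp (V t)) - 1))) by ring.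
        apply Rmult_le_pos; [left; apply exp_pos | ]. apply Rmult_le_pos; lra. }
      assert (h7 := pow2_ge_0 (D1 t)). lra.
    - intros t ht. destruct (hT t ht) as [h1 h2]. destruct (both_nonpositive hs t).
      unfold D. nra. }
  assert (hzero : forall t, t2 <= t -> D t = 0).
  { intros t ht.
    assert (h := nondecreasing (fun s => - D s ^ 2) (fun s => - (2 * D s * D1 s)) t2 t ht).
    cbv beta in h. assert (h2 : - D t2 ^ 2 <= - D t ^ 2).
    { apply h.
      - intros s _. assert (h1 := hD s). derive_from_context.
      - intros s hs'. specialize (hsq s ltac:(lra)). lra. }
    assert (h3 : D t2 = 0) by (unfold D; lra). rewrite h3 in h2.
    assert (h4 := pow2_ge_0 (D t)). nra. }
  assert (hflat : D1 (t2 + 1) = 0).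
  { rewrite <- (is_derive_unique _ _ _ (hD (t2 + 1))).
    rewrite (Derive_ext_loc D (fun _ => 0)); [apply Derive_const | ].
    exists (mkposreal 1 Rlt_0_1). intros y hy. apply hzero.
    change (Rabs (y - (t2 + 1)) < 1) in hy. apply Rabs_def2 in hy. lra. }
  apply (identical_of_contact hs (t2 + 1)); [ | unfold D1 in hflat; lra].
  assert (h := hzero (t2 + 1) ltac:(lra)). unfold D in h. lra.
Qed.

(** The barrier e^(-5r/2), r = e^t, is a supersolution: its second derivative in t is (25/4 e^(2t) -
    5/2 e^t) times itself, less than 25/4 e^(2t) times itself. *)
Lemma difference_decay :
  exists C T, 0 <= C /\ forall t, T <= t -> U t - V t <= C * exp (- (5 / 2 * exp t)).
Proof.
  destruct both_near_zero as [T hT].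
  set (C := Rabs (U T - V T) * exp (5 / 2 * exp T)).
  assert (hC : 0 <= C) by (apply Rmult_le_pos; [apply Rabs_pos | left; apply exp_pos]).
  exists C, T. split; [exact hC | ]. intros t ht.
  enough (U t - V t - C * exp (- (5 / 2 * exp t)) <= 0) by lra.
  apply (half_line_max_principle (fun s => U s - V s - C * exp (- (5 / 2 * exp s)))
    (fun s => U1 s - V1 s + C * (5 / 2 * exp s * exp (- (5 / 2 * exp s))))
    (fun s => exp (2 * s) * (3 * (exp (U s) - exp (V s)) * (2 * (exp (U s) + exp (V s)) - 1))
       - C * ((25 / 4 * exp (2 * s) - 5 / 2 * exp s) * exp (- (5 / 2 * exp s)))) T 1).
  - intros s _. assert (h1 := log_dU _ _ _ _ hs s). assert (h2 := log_dV _ _ _ _ hs s).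
    derive_from_context.
  - intros s _. assert (h1 := log_dU1 _ _ _ _ hs s). assert (h2 := log_dV1 _ _ _ _ hs s).
    rewrite <- rhs_difference. replace (2 * s) with (s + s) in * by ring.
    rewrite exp_plus in *. derive_from_context. field.
  - intros s hs' hz. destruct (hT s hs') as [h1 h2].
    assert (h3 := exp_ge_linear (U s)). assert (h4 := exp_ge_linear (V s)).
    assert (hp := exp_pos (- (5 / 2 * exp s))). assert (hp' := exp_pos s).
    set (phi := exp (- (5 / 2 * exp s))) in *.
    assert (hphi : 0 <= C * phi) by (apply Rmult_le_pos; lra).
    assert (h5 : 19 / 20 * (U s - V s) <= exp (U s) - exp (V s)).
    { replace (U s) with (V s + (U s - V s)) at 2 by ring. rewrite exp_plus.
      assert (h6 := exp_ge_linear (U s - V s)).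
      assert (19 / 20 * (U s - V s) <= exp (V s) * (exp (U s - V s) - 1))
        by (apply Rmult_le_compat; lra). lra. }
    assert (h6 : 25 / 4 * (U s - V s) <=
      3 * (exp (U s) - exp (V s)) * (2 * (exp (U s) + exp (V s)) - 1)).
    { assert (57 / 20 * (U s - V s) * (14 / 5) <=
        3 * (exp (U s) - exp (V s)) * (2 * (exp (U s) + exp (V s)) - 1))
        by (apply Rmult_le_compat; lra). lra. }
    assert (he := exp_pos (2 * s)).
    assert (h7 : exp (2 * s) * (25 / 4 * (U s - V s)) <=
      exp (2 * s) * (3 * (exp (U s) - exp (V s)) * (2 * (exp (U s) + exp (V s)) - 1)))
      by (apply Rmult_le_compat_l; lra).
    assert (h8 : exp (2 * s) * (C * phi) < exp (2 * s) * (U s - V s))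
      by (apply Rmult_lt_compat_l; lra).
    assert (h9 : 0 <= exp s * (C * phi)) by (apply Rmult_le_pos; lra).
    lra.
  - unfold C. rewrite Rmult_assoc, <- exp_plus.
    replace (5 / 2 * exp T + - (5 / 2 * exp T)) with 0 by ring. rewrite exp_0.
    assert (h := Rle_abs (U T - V T)). lra.
  - intros s hs'. destruct (hT s hs'). destruct (both_nonpositive hs s).
    assert (0 <= C * exp (- (5 / 2 * exp s))) by (apply Rmult_le_pos; [exact hC | left; apply exp_pos]).
    lra.
  - exact ht.
Qed.

(** The forcing of the sum is at least U + V, because s^2/2 - s >= s - 2 for s = a + b, and a >= 1 +
    U, b >= 1 + V. For t >= 0 the barrier e^(-2r) has the factor 4 e^(2t) - 2 e^t >= 2 e^(2t), which
    exceeds e^(2t). *)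
Lemma sum_slow_decay :
  (forall t, U t + V t < 0) ->
  exists c, 0 < c /\ forall t, 0 <= t -> c * exp (- (2 * exp t)) <= - (U t + V t).
Proof.
  intros hneg.
  set (c := - (U 0 + V 0) * exp (2 * exp 0)).
  assert (hc : 0 < c) by (apply Rmult_lt_0_compat; [specialize (hneg 0); lra | apply exp_pos]).
  exists c. split; [exact hc | ]. intros t ht.
  enough (c * exp (- (2 * exp t)) + (U t + V t) <= 0) by lra.
  apply (half_line_max_principle (fun s => c * exp (- (2 * exp s)) + (U s + V s))
    (fun s => - c * (2 * exp s * exp (- (2 * exp s))) + (U1 s + V1 s))
    (fun s => c * ((4 * exp (2 * s) - 2 * exp s) * exp (- (2 * exp s)))
       + exp (2 * s) * sum_rhs (exp (U s)) (exp (V s))) 0 c).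
  - intros s _. assert (h1 := log_dU _ _ _ _ hs s). assert (h2 := log_dV _ _ _ _ hs s).
    derive_from_context.
  - intros s _. assert (h1 := log_dU1 _ _ _ _ hs s). assert (h2 := log_dV1 _ _ _ _ hs s).
    rewrite <- rhs_sum. replace (2 * s) with (s + s) in * by ring.
    rewrite exp_plus in *. derive_from_context.
  - intros s hs' hz. set (phi := exp (- (2 * exp s))) in *.
    assert (hphi : 0 < phi) by apply exp_pos.
    assert (h3 := exp_ge_linear (U s)). assert (h4 := exp_ge_linear (V s)).
    assert (h5 : U s + V s <= sum_rhs (exp (U s)) (exp (V s))).
    { unfold sum_rhs. assert (h := pow2_ge_0 (exp (U s) - exp (V s))).
      assert (h' := pow2_ge_0 (exp (U s) + exp (V s) - 2)). nra. }
    assert (he := exp_pos (2 * s)).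
    assert (hee : exp s <= exp (2 * s)) by (apply exp_le; lra).
    assert (h6 : exp (2 * s) * (U s + V s) <= exp (2 * s) * sum_rhs (exp (U s)) (exp (V s)))
      by (apply Rmult_le_compat_l; lra).
    assert (h7 : 0 < c * phi) by (apply Rmult_lt_0_compat; assumption).
    assert (h8 : 0 < exp (2 * s) * (c * phi + (U s + V s))) by (apply Rmult_lt_0_compat; lra).
    assert (h9 : exp s * (c * phi) <= exp (2 * s) * (c * phi)) by (apply Rmult_le_compat_r; lra).
    assert (h10 : 0 < exp (2 * s) * (c * phi)) by (apply Rmult_lt_0_compat; lra).
    lra.
  - unfold c. rewrite Rmult_assoc, <- exp_plus.
    replace (2 * exp 0 + - (2 * exp 0)) with 0 by ring. rewrite exp_0. lra.
  - intros s _. specialize (hneg s).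
    assert (exp (- (2 * exp s)) <= 1).
    { apply exp_le_one. assert (h := exp_pos s). lra. }
    nra.
  - exact ht.
Qed.

End Topological.

Lemma eventually_increasing {U U1 V V1 : R -> R} (hs : log_system U U1 V V1) :
  is_lim U p_infty 0 -> is_lim V p_infty 0 -> (forall t, U t + V t < 0) ->
  exists T, forall t, T <= t -> 0 < U1 t.
Proof.
  intros hU hV hneg.
  destruct (both_near_zero hU hV) as [T0 hT0].
  destruct (difference_decay hs hU hV) as [C1 [T1 [hC1 h1]]].
  destruct (difference_decay (log_system_swap _ _ _ _ hs) hV hU) as [C2 [T2 [hC2 h2]]].
  destruct (sum_slow_decay hs hneg) as [c [hc h3]].
  set (C := C1 + C2).
  (* Past this time 33 |U - V| < -(U + V), hence -U > 16 |U - V|, which dominates the coupling term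
     of [rhs_uE], at most 4 |U - V|. The 66 is 33 doubled, for the exponent e^t / 2. *)
  set (T := Rmax 0 (Rmax T0 (Rmax T1 (Rmax T2 (66 * C / c))))).
  assert (hT : 0 <= T /\ T0 <= T /\ T1 <= T /\ T2 <= T /\ 66 * C / c <= T).
  { unfold T. repeat split; repeat first [apply Rmax_l | apply Rle_refl |
      eapply Rle_trans; [ | apply Rmax_r]]. }
  assert (hf : forall t, T <= t -> rhs_u (U t) (V t) < 0).
  { intros t ht.
    destruct (hT0 t ltac:(lra)) as [hu hv]. destruct (both_nonpositive hs t) as [hu0 hv0].
    specialize (h1 t ltac:(lra)). specialize (h2 t ltac:(lra)). specialize (h3 t ltac:(lra)).
    assert (hp := exp_pos (- (5 / 2 * exp t))).
    assert (hD : Rabs (U t - V t) <= C * exp (- (5 / 2 * exp t))).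
    { unfold C. apply Rabs_le. nra. }
    assert (hsmall : 33 * C * exp (- (exp t / 2)) < c).
    { assert (hexp := exp_ge_linear t).
      apply neg_exp_small; [exact hc | unfold C; lra | assert (h := exp_pos t); lra | ].
      replace (33 * C / c) with (66 * C / c / 2) by (field; lra). lra. }
    assert (hcmp : 33 * Rabs (U t - V t) < - (U t + V t)).
    { eapply Rlt_le_trans; [ | exact h3].
      replace (- (5 / 2 * exp t)) with (- (exp t / 2) + - (2 * exp t)) in hD by field.
      rewrite exp_plus in hD. assert (h := exp_pos (- (2 * exp t))). nra. }
    set (d := Rabs (U t - V t)) in *.
    assert (hd1 := Rle_abs (U t - V t)). fold d in hd1.
    assert (hd2 := Rle_abs (- (U t - V t))). rewrite Rabs_Ropp in hd2. fold d in hd2.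
    assert (ha := exp_le_one _ hu0). assert (hb := exp_le_one _ hv0).
    assert (ha' := exp_ge_linear (U t)). assert (hb' := exp_ge_linear (V t)).
    assert (hlip := exp_lipschitz _ _ hu0 hv0). fold d in hlip.
    assert (hlip' : exp (U t) - exp (V t) <= d) by (eapply Rle_trans; [apply Rle_abs | exact hlip]).
    assert (h1a : - exp (U t) * U t <= 1 - exp (U t)).
    { assert (h := exp_ge_linear (- U t)).
      assert (hi : exp (U t) * exp (- U t) = 1) by (rewrite <- exp_plus, <- exp_0; f_equal; ring).
      nra. }
    rewrite rhs_uE.
    set (a := exp (U t)) in *. set (b := exp (V t)) in *.
    assert (h4 : 19 / 20 * - U t <= a * - U t) by (apply Rmult_le_compat_r; lra).
    assert (h5 : 0 <= (a - 19 / 20) * (1 - a)) by (apply Rmult_le_pos; lra).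
    assert (h6 : (a - b) * (3 * a + 2 * b - 1) <= d * 4).
    { destruct (Rle_dec b a) as [h | h]; [apply Rmult_le_compat; lra | ].
      assert (0 <= d) by apply Rabs_pos.
      assert (0 <= (b - a) * (3 * a + 2 * b - 1)) by (apply Rmult_le_pos; lra). lra. }
    lra. }
  exists T. intros t ht.
  (* Concavity and the lower bound on U give a nonnegative slope; its strict decrease over one unit
     makes it positive. *)
  assert (hstrict : U1 (t + 1) < U1 t).
  { assert (h := strictly_increasing (fun s => - U1 s) _ t (t + 1) ltac:(lra)
      (fun s _ => is_derive_opp _ s _ (log_dU1 _ _ _ _ hs s))).
    cbv beta in h. enough (- U1 t < - U1 (t + 1)) by lra. apply h.
    intros s hs'. specialize (hf s ltac:(lra)). assert (he := exp_pos (2 * s)).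
    change (0 < - (exp (2 * s) * rhs_u (U s) (V s))). nra. }
  assert (hge := convex_bounded_nonincreasing (fun s => - U s) (fun s => - U1 s) _ T 1
    (fun s _ => is_derive_opp _ s _ (log_dU _ _ _ _ hs s))
    (fun s _ => is_derive_opp _ s _ (log_dU1 _ _ _ _ hs s))
    ltac:(intros s hs'; specialize (hf s hs'); assert (he := exp_pos (2 * s));
          change (0 <= - (exp (2 * s) * rhs_u (U s) (V s))); nra)
    ltac:(intros s hs'; destruct (hT0 s ltac:(lra)); lra) (t + 1) ltac:(lra)).
  cbv beta in hge. lra.
Qed.

(** * Passage to logarithmic time and conclusion *)

(** In the transverse direction rho' = t / rho vanishes at 0, so f'' drops out there and the slope
    1/r of t / rho leaves f' / r. *)
Lemma laplacian_radial_on_axis (f : R -> R) (r : R) :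
  twice_derivable_pos f -> 0 < r ->
  laplacian (radial f) r 0 = Derive (Derive f) r + Derive f r / r.
Proof.
  intros hf hr. unfold laplacian. f_equal.
  - rewrite (Derive_n_ext_loc _ f).
    + reflexivity.
    + exists (mkposreal r hr). intros s hs.
      change (Rabs (s - r) < r) in hs. apply Rabs_def2 in hs.
      unfold radial. f_equal. replace (s ^ 2 + 0 ^ 2) with (s * s) by ring.
      apply sqrt_square. lra.
  - set (rho := fun t : R => sqrt (r ^ 2 + t ^ 2)).
    assert (hrho : forall t, 0 < rho t).
    { intros t. apply sqrt_lt_R0. assert (h := pow2_ge_0 t). nra. }
    assert (hdrho : forall t : R, is_derive rho t (t / rho t)).
    { intros t. assert (h := hrho t). unfold rho in *. auto_derive.
      - assert (h' := pow2_ge_0 t). nra.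
      - replace (r * (r * 1) + t * (t * 1)) with (r ^ 2 + t ^ 2) by ring.
        field. lra. }
    assert (hd1 : forall t, Derive (fun t => radial f r t) t = Derive f (rho t) * (t / rho t)).
    { intros t. apply is_derive_unique.
      destruct (hf (rho t) (hrho t)) as [h1 _].
      assert (h2 := is_derive_comp f rho t _ _ (Derive_correct _ _ h1) (hdrho t)).
      rewrite Rmult_comm. exact h2. }
    change (Derive_n (fun t => radial f r t) 2 0)
      with (Derive (fun t => Derive (fun t => radial f r t) t) 0).
    transitivity (Derive (fun t => Derive f (rho t) * (t / rho t)) 0).
    { apply Derive_ext. exact hd1. }
    assert (h0 : rho 0 = r).
    { unfold rho. replace (r ^ 2 + 0 ^ 2) with (r * r) by ring. apply sqrt_square. lra. }
    apply is_derive_unique.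
    destruct (hf (rho 0) (hrho 0)) as [_ h2].
    assert (h3 := is_derive_comp (Derive f) rho 0 _ _ (Derive_correct _ _ h2) (hdrho 0)).
    assert (h4 : is_derive (fun t => t / rho t) 0 (/ r)).
    { assert (h := hdrho 0). assert (h' := hrho 0). derive_from_context.
      - lra.
      - rewrite h0. field. lra. }
    assert (h5 := is_derive_mult _ _ 0 _ _ h3 h4 ltac:(intros; apply Rmult_comm)).
    cbv beta in h5. rewrite h0 in h5.
    replace (Derive f r / r) with
      (plus (mult (scal (0 / r) (Derive (Derive f) r)) (0 / r)) (mult (Derive f r) (/ r))).
    + exact h5.
    + unfold plus, mult, scal; simpl. unfold mult; simpl. field. lra.
Qed.

Definition log_profile (f : R -> R) (t : R) : R := f (exp t).

Definition log_slope (f : R -> R) (t : R) : R := exp t * Derive f (exp t).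

Lemma log_profile_ln (f : R -> R) (r : R) : 0 < r -> log_profile f (ln r) = f r.
Proof. intros hr. unfold log_profile. rewrite exp_ln; auto. Qed.

Lemma log_system_of_entire (N1 N2 : R) (u v : R -> R) :
  0 <= N1 -> 0 <= N2 -> entire_radial_solution N1 N2 u v ->
  log_system (log_profile u) (log_slope u) (log_profile v) (log_slope v).
Proof.
  intros hN1 hN2 [hu [hv [heq [hsu hsv]]]].
  assert (hd : forall f, twice_derivable_pos f -> forall t : R,
            is_derive (log_profile f) t (log_slope f t)).
  { intros f hf t. destruct (hf _ (exp_pos t)) as [h1 _].
    apply Derive_correct in h1. unfold log_profile, log_slope.
    apply (is_derive_comp f exp t _ _ h1 (is_derive_exp t)). }
  assert (hd2 : forall f, twice_derivable_pos f -> forall t : R,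
            is_derive (log_slope f) t (exp (2 * t) * laplacian (radial f) (exp t) 0)).
  { intros f hf t. rewrite (laplacian_radial_on_axis f _ hf (exp_pos t)).
    destruct (hf _ (exp_pos t)) as [_ h2]. apply Derive_correct in h2.
    assert (h3 := is_derive_comp (Derive f) exp t _ _ h2 (is_derive_exp t)).
    assert (h4 := is_derive_mult _ _ t _ _ (is_derive_exp t) h3 ltac:(intros; apply Rmult_comm)).
    unfold log_slope. evar_last; [exact h4 | ].
    unfold plus, mult, scal; simpl. unfold mult; simpl.
    replace (2 * t) with (t + t) by ring. rewrite exp_plus.
    assert (h := exp_pos t). field. lra. }
  assert (haxis : forall t, laplacian (radial u) (exp t) 0 = rhs_u (log_profile u t) (log_profile v t)
            /\ laplacian (radial v) (exp t) 0 = rhs_v (log_profile u t) (log_profile v t)).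
  { intros t. assert (hp := exp_pos t).
    assert (hr : forall f, radial f (exp t) 0 = log_profile f t).
    { intros f. unfold radial, log_profile. f_equal.
      replace (exp t ^ 2 + 0 ^ 2) with (exp t * exp t) by ring. apply sqrt_square. lra. }
    destruct (heq (exp t) 0) as [h1 h2].
    - intros h. injection h. lra.
    - rewrite !hr in h1, h2. auto. }
  assert (hbd : forall N f, 0 <= N -> log_singularity N f ->
            exists T M, forall t, t <= T -> log_profile f t <= M).
  { intros N f hN [C [delta [hdelta h]]].
    (* For N >= 0 and t <= 0 the term 2Nt is nonpositive, so C bounds the profile from above. *)
    exists (Rmin 0 (ln delta - 1)), C. intros t ht.
    assert (h1 : t <= 0) by (eapply Rle_trans; [exact ht | apply Rmin_l]).
    assert (h2 : t <= ln delta - 1) by (eapply Rle_trans; [exact ht | apply Rmin_r]).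
    assert (h3 : exp t < delta).
    { rewrite <- (exp_ln delta hdelta). apply exp_increasing. lra. }
    specialize (h (exp t) (conj (exp_pos t) h3)). rewrite ln_exp in h.
    assert (h4 := Rle_trans _ _ _ (Rle_abs _) h). unfold log_profile. nra. }
  split; auto.
  - intros t. destruct (haxis t) as [<- _]. auto.
  - intros t. destruct (haxis t) as [_ <-]. auto.
  - destruct (hbd N1 u hN1 hsu) as [T1 [M1 h1]]. destruct (hbd N2 v hN2 hsv) as [T2 [M2 h2]].
    exists (Rmin T1 T2), (Rmax M1 M2). intros t ht. split.
    + eapply Rle_trans; [apply h1; eapply Rle_trans; [exact ht | apply Rmin_l] | apply Rmax_l].
    + eapply Rle_trans; [apply h2; eapply Rle_trans; [exact ht | apply Rmin_r] | apply Rmax_r].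
Qed.

Lemma is_lim_log_profile (f : R -> R) (l : R) :
  is_lim (log_profile f) p_infty l <-> is_lim f p_infty l.
Proof.
  rewrite !is_lim_at_infinity. split; intros h eps heps; destruct (h eps heps) as [T hT].
  - exists (exp T). intros r hr. assert (hp := exp_pos T).
    rewrite <- (log_profile_ln f r) by lra. apply hT.
    rewrite <- (ln_exp T). apply ln_increasing; assumption.
  - exists (ln (Rmax 1 T)). intros t ht. apply hT.
    assert (h1 := Rmax_l 1 T). assert (h2 := Rmax_r 1 T).
    apply exp_increasing in ht. rewrite exp_ln in ht by lra. lra.
Qed.

Lemma monotone_bounded_limit (f : R -> R) (a M : R) :
  (forall s t, a <= s <= t -> f s <= f t) -> (forall t, a <= t -> f t <= M) ->
  exists l : R, is_lim f p_infty l /\ forall t, a <= t -> f t <= l.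
Proof.
  intros hmon hM.
  destruct (completeness (fun y => exists t, a <= t /\ y = f t)) as [l [hub hlub]].
  - exists M. intros y [t [ht ->]]. auto.
  - exists (f a), a. split; [lra | reflexivity].
  - assert (hle : forall t, a <= t -> f t <= l) by (intros t ht; apply hub; exists t; auto).
    exists l. split; [ | exact hle]. apply is_lim_at_infinity. intros eps heps.
    assert (hex : exists t, a <= t /\ l - eps < f t).
    { apply NNPP. intros hn. assert (l <= l - eps); [ | lra].
      apply hlub. intros y [t [ht ->]]. apply Rnot_lt_le. intros h. apply hn. exists t. auto. }
    destruct hex as [T [haT hT]]. exists T. intros t ht.
    assert (h1 := hmon T t ltac:(lra)). assert (h2 := hle t ltac:(lra)).
    apply Rabs_def1; lra.
Qed.

Section Alternative.
Context {U U1 V V1 : R -> R} (hs : log_system U U1 V V1).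

Lemma vanishing_of_sum_vanishing :
  is_lim (fun t => U t + V t) p_infty 0 -> is_lim U p_infty 0 /\ is_lim V p_infty 0.
Proof.
  rewrite !is_lim_at_infinity. intros h.
  split; intros eps heps; destruct (h eps heps) as [T hT]; exists T; intros t ht;
    specialize (hT t ht); apply Rabs_def2 in hT; destruct (both_nonpositive hs t);
    apply Rabs_def1; lra.
Qed.

Lemma vanishing_of_sum_increasing :
  (forall t, 0 < U1 t + V1 t) -> is_lim U p_infty 0 /\ is_lim V p_infty 0.
Proof.
  intros hp.
  destruct (monotone_bounded_limit (fun t => U t + V t) 0 0) as [l [hl _]].
  - intros s t hst.
    apply (nondecreasing (fun t => U t + V t) (fun t => U1 t + V1 t)); [lra | | ].
    + intros x _. apply (sum_derive hs).
    + intros x _. left. apply hp.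
  - intros t _. apply (sum_nonpositive hs).
  - rewrite (sum_limit_zero hs l hl) in hl. apply vanishing_of_sum_vanishing, hl.
Qed.

Lemma below_half_of_sum_critical (t1 : R) :
  (forall t, U t + V t < 0) -> U1 t1 + V1 t1 <= 0 ->
  exists T, forall t, T <= t -> U t < ln (1 / 2) /\ V t < ln (1 / 2).
Proof.
  intros hneg h1.
  destruct (sum_nonincreasing_after hs t1 hneg h1) as [t0 h0].
  assert (hmon : forall s t, t0 <= s <= t -> - (U s + V s) <= - (U t + V t)).
  { intros s t hst.
    apply (nondecreasing (fun t => - (U t + V t)) (fun t => - (U1 t + V1 t))); [lra | | ].
    - intros x _. apply (is_derive_opp (fun t => U t + V t)), (sum_derive hs).
    - intros x hx. specialize (h0 x ltac:(lra)). lra. }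
  (* Being monotone, the sum would otherwise converge; its limit could only be 0, yet it stays at or
     below its negative value at t0. *)
  assert (hdiv : forall B, exists T, forall t, T <= t -> U t + V t <= B).
  { intros B. apply NNPP. intros hn.
    destruct (monotone_bounded_limit (fun t => - (U t + V t)) t0 (- B) hmon) as [l [hl hle]].
    - intros t ht. apply Rnot_lt_le. intros hlt. apply hn. exists t. intros s hts.
      specialize (hmon t s ltac:(lra)). lra.
    - apply is_lim_opp in hl. cbn in hl.
      apply (is_lim_ext _ (fun t => U t + V t)) in hl; [ | intros; ring].
      assert (h := sum_limit_zero hs (- l) hl).
      specialize (hle t0 ltac:(lra)). specialize (hneg t0). cbv beta in hle. lra. }
  destruct (eventually_below_half hs hdiv) as [T1 hT1].
  destruct (eventually_below_half (log_system_swap _ _ _ _ hs)) as [T2 hT2].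
  { intros B. destruct (hdiv B) as [T hT]. exists T. intros t ht.
    rewrite Rplus_comm. auto. }
  exists (Rmax T1 T2). intros t ht.
  split; [apply hT1 | apply hT2]; eapply Rle_trans; try exact ht; [apply Rmax_l | apply Rmax_r].
Qed.

End Alternative.

Theorem theorem1p3 (N1 N2 : R) (u v : R -> R)
    (hN1 : 0 <= N1) (hN2 : 0 <= N2)
    (huv : entire_radial_solution N1 N2 u v) :
  exists R0 : R, 0 <= R0 /\
    ((forall r, 0 < r -> R0 <= r -> u r < ln (1 / 2) /\ v r < ln (1 / 2))
     \/ topological_solution N1 N2 u v) /\
    (~ trivial_pair u v ->
       (topological_solution N1 N2 u v <->
        (forall r, 0 < r -> 0 < r * Derive (fun s => u s + v s) r))) /\
    (topological_solution N1 N2 u v ->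
       (~ identical_pair u v ->
          forall r, R0 < r -> ~ intersection u v r) /\
       (~ trivial_pair u v ->
          increasing_on_ray R0 u /\ increasing_on_ray R0 v) /\
       is_lim u p_infty 0 /\ is_lim v p_infty 0).
Proof.
  assert (hs := log_system_of_entire N1 N2 u v hN1 hN2 huv).
  assert (htopo : is_lim (log_profile u) p_infty 0 /\ is_lim (log_profile v) p_infty 0 ->
            topological_solution N1 N2 u v).
  { intros [h1 h2]. split; [exact huv | split; apply is_lim_log_profile; assumption]. }
  destruct (classic (trivial_pair u v)) as [htriv | hntriv].
  { assert (hlim : is_lim u p_infty 0 /\ is_lim v p_infty 0).
    { split; apply is_lim_at_infinity; intros eps heps; exists 0; intros r hr;
        destruct (htriv r hr) as [e1 e2]; rewrite ?e1, ?e2, Rminus_0_r, Rabs_R0; exact heps. }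
    exists 0. split; [lra | split; [right; split; assumption | split; [contradiction | ]]].
    intros _. split; [ | split; [contradiction | exact hlim]].
    intros hid. exfalso. apply hid. intros r hr. destruct (htriv r hr). lra. }
  assert (hneg : forall t, log_profile u t + log_profile v t < 0).
  { intros t. destruct (Rle_lt_or_eq_dec _ _ (sum_nonpositive hs t)) as [h | h]; [exact h | ].
    exfalso. apply hntriv. intros r hr.
    assert (h' := trivial_of_sum_zero hs t h (ln r)). rewrite !log_profile_ln in h' by exact hr.
    exact h'. }
  assert (hslope : forall r, 0 < r ->
            r * Derive (fun s => u s + v s) r = log_slope u (ln r) + log_slope v (ln r)).
  { intros r hr. destruct huv as [hu [hv _]].
    rewrite Derive_plus; [ | apply hu, hr | apply hv, hr].
    unfold log_slope. rewrite exp_ln by exact hr. ring. }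
  (* A nonpositive slope of the sum at some time leads to (1) and excludes a topological solution;
     positivity throughout leads to (2). Both sides of (a) are thereby decided in each branch. *)
  destruct (classic (exists t1, log_slope u t1 + log_slope v t1 <= 0)) as [[t1 h1] | hn].
  - destruct (below_half_of_sum_critical hs t1 hneg h1) as [T hT].
    assert (hnot : ~ topological_solution N1 N2 u v).
    { intros [_ [hu _]].
      assert (hl : 0 < - ln (1 / 2)).
      { assert (h := ln_increasing (1 / 2) 1 ltac:(lra) ltac:(lra)). rewrite ln_1 in h. lra. }
      apply is_lim_log_profile in hu.
      destruct (vanishing_lower_bound _ _ hl hu) as [T' hT'].
      destruct (hT (Rmax T T') (Rmax_l _ _)) as [h _].
      specialize (hT' (Rmax T T') (Rmax_r _ _)). lra. }
    exists (exp T). split; [left; apply exp_pos | split; [left | split; [ | contradiction]]].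
    + intros r hr hTr.
      rewrite <- (log_profile_ln u r), <- (log_profile_ln v r) by exact hr. apply hT.
      rewrite <- (ln_exp T). destruct hTr as [h | ->]; [ | lra].
      left. apply ln_increasing; [apply exp_pos | exact h].
    + intros _. split; [contradiction | ]. intros h.
      specialize (h (exp t1) (exp_pos t1)). rewrite (hslope _ (exp_pos t1)), ln_exp in h. lra.
  - assert (hpos : forall t, 0 < log_slope u t + log_slope v t).
    { intros t. apply Rnot_le_lt. intros h. apply hn. exists t. exact h. }
    destruct (vanishing_of_sum_increasing hs hpos) as [hu hv].
    assert (ht := htopo (conj hu hv)).
    destruct (eventually_increasing hs hu hv hneg) as [T1 hT1].
    destruct (eventually_increasing (log_system_swap _ _ _ _ hs) hv hu) as [T2 hT2].
    { intros t. rewrite Rplus_comm. apply hneg. }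
    destruct (late_contact_identical hs hu hv) as [T3 hT3].
    set (T := Rmax T1 (Rmax T2 T3)).
    assert (hT : T1 <= T /\ T2 <= T /\ T3 <= T).
    { unfold T. repeat split; [apply Rmax_l | | ]; (eapply Rle_trans; [ | apply Rmax_r]);
        [apply Rmax_l | apply Rmax_r]. }
    assert (hlog : forall r, exp T < r -> 0 < r /\ T < ln r).
    { intros r hr. assert (hp := exp_pos T). split; [lra | ].
      rewrite <- (ln_exp T). apply ln_increasing; assumption. }
    assert (hinc : forall f, twice_derivable_pos f ->
              (forall t, T <= t -> 0 < log_slope f t) ->
              (forall t : R, is_derive (log_profile f) t (log_slope f t)) ->
              increasing_on_ray (exp T) f).
    { intros f hf hsl hd r s hr hrs.
      destruct (hlog r hr) as [hr0 hrT].
      assert (hln : ln r < ln s) by (apply ln_increasing; assumption).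
      rewrite <- (log_profile_ln f r), <- (log_profile_ln f s) by lra.
      apply (strictly_increasing _ _ _ _ hln (fun t _ => hd t)).
      intros t hts. apply hsl. lra. }
    exists (exp T). split; [left; apply exp_pos | split; [right; exact ht | split]].
    + intros _. split; [intros _ | intros _; exact ht].
      intros r hr. rewrite (hslope r hr). apply hpos.
    + intros _. split; [ | split; [ | split; apply is_lim_log_profile; assumption]].
      * intros hid r hr hint. apply hid. intros x hx.
        destruct (hlog r hr) as [hr0 hrT].
        assert (h := hT3 (ln r) ltac:(lra)). rewrite !log_profile_ln in h by exact hr0.
        specialize (h hint (ln x)). rewrite !log_profile_ln in h by exact hx. exact h.
      * intros _. split; apply hinc.
        -- apply huv.
        -- intros t ht'. apply hT1. lra.
        -- apply (log_dU _ _ _ _ hs).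
        -- apply huv.
        -- intros t ht'. apply hT2. lra.
        -- apply (log_dV _ _ _ _ hs).
Qed.
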